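(* Let $A\in\mathcal{R}(\mathbb{T},\mathbb{H}^{n\times n})$, let $M(t)$ be a fundamental solution matrix of $\phi^\Delta(t)=A(t)\phi(t)$, let $t_0\in\mathbb{T}$, and suppose that $f:\mathbb{T}\to\mathbb{H}^n$ is rd-continuous. Then the general solution of $\phi^\Delta(t)=A(t)\phi(t)+f(t)$ is given by $$\phi^{NH}(t)=M(t)q+M(t)\int_{t_0}^t M^{-1}(\sigma(\tau))f(\tau)\,\Delta\tau,$$ where $q=(q_1,\dots,q_n)^\top\in\mathbb{H}^n$ is a constant quaternion vector; that is, for every such $q$ this formula defines a solution, and every solution is of this form for some $q$.
   Context: A time scale $\mathbb{T}$ is a nonempty closed subset of $\mathbb{R}$. For $t\in\mathbb{T}$: $\sigma(t)=\inf\{s\in\mathbb{T}:s>t\}$, $\rho(t)=\sup\{s\in\mathbb{T}:s<t\}$ (with $\inf\emptyset=\sup\mathbb{T}$, $\sup\emptyset=\inf\mathbb{T}$), $\mu(t)=\sigma(t)-t$. The point $t$ is right-dense if $\sigma(t)=t$ and left-dense if $\rho(t)=t$. $\mathbb{T}^\kappa=\mathbb{T}\setminus(\rho(\sup\mathbb{T}),\sup\mathbb{T}]$ if $\sup\mathbb{T}<\infty$, and $\mathbb{T}^\kappa=\mathbb{T}$ otherwise. $\mathbb{H}$ is the skew field of quaternions. A function $g:\mathbb{T}\to\mathbb{H}$ has delta derivative $g^\Delta(t)$ at $t\in\mathbb{T}^\kappa$ if for every $\varepsilon>0$ there is $\delta>0$ with $|g(\sigma(t))-g(s)-g^\Delta(t)(\sigma(t)-s)|\le\varepsilon|\sigma(t)-s|$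 for all $s\in(t-\delta,t+\delta)\cap\mathbb{T}$. $g$ is rd-continuous if each of its four real components is continuous at right-dense points and has finite left-sided limits at left-dense points. For rd-continuous $g$, $\int_r^s g(t)\Delta t=G(s)-G(r)$, where $G^\Delta=g$ on $\mathbb{T}^\kappa$. For vector- and matrix-valued functions these notions are entrywise. $\mathcal{R}(\mathbb{T},\mathbb{H}^{n\times n})$ is the set of rd-continuous $A:\mathbb{T}\to\mathbb{H}^{n\times n}$ that are regressive, i.e. $I_n+\mu(t)A(t)$ is invertible for all $t\in\mathbb{T}^\kappa$. A solution of a dynamic equation is a delta differentiable function $\mathbb{T}\to\mathbb{H}^n$ satisfying it at every $t\in\mathbb{T}^\kappa$. Functions $x_1,\dots,x_n:\mathbb{T}\to\mathbb{H}^n$ are right linearly independent on $\mathbb{T}$ if $x_1(t)\alpha_1+\dots+x_n(t)\alpha_n=0$ for all $t\in\mathbb{T}$, with $\alpha_i\in\mathbb{H}$, implies all $\alpha_i=0$. A fundamental solution matrix of $\phi^\Delta=A\phi$ is an $n\times n$ matrix function whose columns are $n$ right linearly independent solutions (such a matrix is invertible at every $t\in\mathbb{T}$). $M^{-1}(\sigma(\tau))$ is the inverse of the matrix $M(\sigma(\tau))$. *)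

(* Defs.v *)
From HB Require Import structures.
From mathcomp Require Import all_boot all_order all_algebra.
From mathcomp Require Import ring lra.
From mathcomp Require Import boolp classical_sets reals topology normedtype.

Set Implicit Arguments.
Unset Strict Implicit.
Unset Printing Implicit Defensive.

Import Order.TTheory GRing.Theory Num.Theory.
Import numFieldNormedType.Exports.

Local Open Scope classical_set_scope.
Local Open Scope ring_scope.

(* [Quat a b c d] is a + b i + c j + d k. *)
Record quat (R : realType) := Quat { qre : R; qi : R; qj : R; qk : R }.

Definition quat_tuple (R : realType) (x : quat R) : R * R * R * R :=
  (qre x, qi x, qj x, qk x).

Definition tuple_quat (R : realType) (x : R * R * R * R) : quat R :=
  Quat x.1.1.1 x.1.1.2 x.1.2 x.2.

Lemma quat_tupleK (R : realType) : cancel (@quat_tuple R) (@tuple_quat R).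
Proof. by case. Qed.

HB.instance Definition _ (R : realType) :=
  Choice.copy (quat R) (can_type (@quat_tupleK R)).

Definition quat_add (R : realType) (x y : quat R) : quat R :=
  Quat (qre x + qre y) (qi x + qi y) (qj x + qj y) (qk x + qk y).

Definition quat_opp (R : realType) (x : quat R) : quat R :=
  Quat (- qre x) (- qi x) (- qj x) (- qk x).

(* Embedding of the real scalars. *)
Definition rquat (R : realType) (c : R) : quat R := Quat c 0 0 0.

(* i^2 = j^2 = k^2 = ijk = -1 *)
Definition quat_mul (R : realType) (x y : quat R) : quat R :=
  Quat (qre x * qre y - qi x * qi y - qj x * qj y - qk x * qk y)
       (qre x * qi y + qi x * qre y + qj x * qk y - qk x * qj y)
       (qre x * qj y - qi x * qk y + qj x * qre y + qk x * qi y)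
       (qre x * qk y + qi x * qj y - qj x * qi y + qk x * qre y).

Fact quat_addA (R : realType) : associative (@quat_add R).
Proof. by move=> x y z; congr Quat; rewrite /= addrA. Qed.

Fact quat_addC (R : realType) : commutative (@quat_add R).
Proof. by move=> x y; congr Quat; rewrite /= addrC. Qed.

Fact quat_add0 (R : realType) : left_id (@rquat R 0) (@quat_add R).
Proof. by case=> a b c d; rewrite /quat_add /= !add0r. Qed.

Fact quat_addN (R : realType) : left_inverse (@rquat R 0) (@quat_opp R) (@quat_add R).
Proof. by move=> x; congr Quat; rewrite /= addNr. Qed.

HB.instance Definition _ (R : realType) :=
  GRing.isZmodule.Build (quat R)
    (@quat_addA R) (@quat_addC R) (@quat_add0 R) (@quat_addN R).

Fact quat_mulA (R : realType) : associative (@quat_mul R).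
Proof. by move=> x y z; congr Quat => /=; ring. Qed.

Fact quat_mul1l (R : realType) : left_id (@rquat R 1) (@quat_mul R).
Proof. by case=> a b c d; congr Quat => /=; ring. Qed.

Fact quat_mul1r (R : realType) : right_id (@rquat R 1) (@quat_mul R).
Proof. by case=> a b c d; congr Quat => /=; ring. Qed.

Fact quat_mulDl (R : realType) : left_distributive (@quat_mul R) (@quat_add R).
Proof. by move=> x y z; congr Quat => /=; ring. Qed.

Fact quat_mulDr (R : realType) : right_distributive (@quat_mul R) (@quat_add R).
Proof. by move=> x y z; congr Quat => /=; ring. Qed.

Fact quat_one_neq0 (R : realType) : @rquat R 1 != 0.
Proof. by apply/eqP => -[] /eqP; rewrite oner_eq0. Qed.

HB.instance Definition _ (R : realType) :=
  GRing.Zmodule_isNzRing.Build (quat R)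
    (@quat_mulA R) (@quat_mul1l R) (@quat_mul1r R)
    (@quat_mulDl R) (@quat_mulDr R) (@quat_one_neq0 R).

Definition qsqn (R : realType) (x : quat R) : R :=
  qre x ^+ 2 + qi x ^+ 2 + qj x ^+ 2 + qk x ^+ 2.

Definition qnorm (R : realType) (x : quat R) : R := Num.sqrt (qsqn x).

Definition quat_inv (R : realType) (x : quat R) : quat R :=
  Quat (qre x / qsqn x) (- qi x / qsqn x) (- qj x / qsqn x) (- qk x / qsqn x).

Fact qsqn_eq0 (R : realType) (x : quat R) : (qsqn x == 0) = (x == 0).
Proof.
apply/eqP/eqP => [|->]; last first.
  by rewrite /qsqn /= expr0n /= !addr0.
case: x => a b c d; rewrite /qsqn /= => /eqP.
rewrite !paddr_eq0 ?addr_ge0 ?sqr_ge0 // !sqrf_eq0.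
by move=> /andP[/andP[/andP[/eqP -> /eqP ->] /eqP ->] /eqP ->].
Qed.

Fact quat_mulVl (R : realType) :
  {in predC1 (0 : quat R), left_inverse 1 (@quat_inv R) *%R}.
Proof.
move=> x; rewrite inE -qsqn_eq0; case: x => a b c d; rewrite /qsqn /= => h.
by congr Quat; rewrite /= /qsqn /=; field => //.
Qed.

Fact quat_mulVr (R : realType) :
  {in predC1 (0 : quat R), right_inverse 1 (@quat_inv R) *%R}.
Proof.
move=> x; rewrite inE -qsqn_eq0; case: x => a b c d; rewrite /qsqn /= => h.
by congr Quat; rewrite /= /qsqn /=; field => //.
Qed.

Fact quat_unitP (R : realType) (x y : quat R) :
  y * x = 1 /\ x * y = 1 -> predC1 (0 : quat R) x.
Proof.
move=> [yx _]; apply/eqP => x0.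
by move/eqP: yx; rewrite x0 mulr0 eq_sym oner_eq0.
Qed.

Fact quat_inv_out (R : realType) :
  {in [predC predC1 (0 : quat R)], @quat_inv R =1 id}.
Proof.
move=> x; rewrite !inE negbK => /eqP ->.
by congr Quat; rewrite /= ?oppr0 mul0r.
Qed.

HB.instance Definition _ (R : realType) :=
  GRing.NzRing_hasMulInverse.Build (quat R)
    (@quat_mulVl R) (@quat_mulVr R) (@quat_unitP R) (@quat_inv_out R).

(* The entries do not commute, so [unitmx] and [invmx] are not available. *)
Definition is_qinvmx (R : realType) n (A B : 'M[quat R]_n) :=
  A *m B = 1%:M /\ B *m A = 1%:M.

Definition qinvertible (R : realType) n (A : 'M[quat R]_n) :=
  exists B, is_qinvmx A B.

(* Junk value 0 when [A] is not invertible. *)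
Definition qinvmx (R : realType) n (A : 'M[quat R]_n) : 'M[quat R]_n :=
  xget 0 [set B | is_qinvmx A B].

(* Functions on a time scale [T] are total functions on [R] of which only the
   values on [T] matter. *)
Definition time_scale (R : realType) (T : set R) := T !=set0 /\ closed T.

(* The test implements inf set0 = sup T; for t in T the set is empty only
   when t = sup T, so [sup] is never taken of an unbounded set. *)
Definition sigma (R : realType) (T : set R) (t : R) : R :=
  if `[< [set s | T s /\ t < s] !=set0 >]
  then inf [set s | T s /\ t < s] else sup T.

Definition rho (R : realType) (T : set R) (t : R) : R :=
  if `[< [set s | T s /\ s < t] !=set0 >]
  then sup [set s | T s /\ s < t] else inf T.

Definition mu (R : realType) (T : set R) (t : R) : R := sigma T t - t.

Definition right_dense (R : realType) (T : set R) (t : R) :=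
  T t /\ sigma T t = t.

Definition left_dense (R : realType) (T : set R) (t : R) :=
  T t /\ rho T t = t.

Definition kappa (R : realType) (T : set R) : set R :=
  [set t | T t /\ (has_ubound T -> ~ (rho T (sup T) < t <= sup T))].

Definition is_delta_deriv (R : realType) (T : set R) (g : R -> quat R)
    (t : R) (d : quat R) :=
  forall eps : R, 0 < eps -> exists delta : R, 0 < delta /\
    forall s : R, T s -> t - delta < s < t + delta ->
      qnorm (g (sigma T t) - g s - d * rquat (sigma T t - s))
        <= eps * `|sigma T t - s|.

Definition is_delta_deriv_mx (R : realType) (T : set R) m n
    (g : R -> 'M[quat R]_(m, n)) (t : R) (d : 'M[quat R]_(m, n)) :=
  forall i j, is_delta_deriv T (fun s => g s i j) t (d i j).

Definition rd_continuousR (R : realType) (T : set R) (g : R -> R) :=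
  (forall t, right_dense T t -> g s @[s --> within T (nbhs t)] --> g t) /\
  (forall t, left_dense T t ->
    exists l : R, g s @[s --> within T (at_left t)] --> l).

Definition rd_continuous (R : realType) (T : set R) (g : R -> quat R) :=
  [/\ rd_continuousR T (fun t => qre (g t)),
      rd_continuousR T (fun t => qi (g t)),
      rd_continuousR T (fun t => qj (g t)) &
      rd_continuousR T (fun t => qk (g t))].

Definition rd_continuous_mx (R : realType) (T : set R) m n
    (g : R -> 'M[quat R]_(m, n)) :=
  forall i j, rd_continuous T (fun t => g t i j).

Definition is_antiderivative (R : realType) (T : set R) (g G : R -> quat R) :=
  forall t, kappa T t -> is_delta_deriv T G t (g t).

(* [xget] selects an antiderivative (junk value 0 if there is none); the
   difference does not depend on the one selected when r and s are in T. *)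
Definition delta_int (R : realType) (T : set R) (g : R -> quat R)
    (r s : R) : quat R :=
  let G := xget (fun=> 0) [set G | is_antiderivative T g G] in G s - G r.

Definition delta_int_mx (R : realType) (T : set R) m n
    (g : R -> 'M[quat R]_(m, n)) (r s : R) : 'M[quat R]_(m, n) :=
  \matrix_(i, j) delta_int T (fun t => g t i j) r s.

(* [rquat (mu T t)] is central, so the side on which it acts is irrelevant. *)
Definition rd_regressive (R : realType) (T : set R) n
    (A : R -> 'M[quat R]_n) :=
  rd_continuous_mx T A /\
  forall t, kappa T t -> qinvertible (1%:M + rquat (mu T t) *: A t).

(* Solutions of phi^Delta(t) = F(t, phi(t)). *)
Definition is_solution (R : realType) (T : set R) n
    (F : R -> 'cV[quat R]_n -> 'cV[quat R]_n) (phi : R -> 'cV[quat R]_n) :=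
  forall t, kappa T t -> is_delta_deriv_mx T phi t (F t (phi t)).

(* [v *m a%:M], with a%:M of size 1 x 1, is v multiplied by a on the right
   (whereas [a *: v] multiplies on the left). *)
Definition right_independent (R : realType) (T : set R) m n
    (x : 'I_m -> R -> 'cV[quat R]_n) :=
  forall alpha : 'I_m -> quat R,
    (forall t, T t -> \sum_(i < m) x i t *m (alpha i)%:M = 0) ->
    forall i, alpha i = 0.

Definition fundamental_matrix (R : realType) (T : set R) n
    (A M : R -> 'M[quat R]_n) :=
  (forall j, is_solution T (fun t x => A t *m x) (fun t => col j (M t))) /\
  right_independent T (fun j t => col j (M t)).

(* Main.v *)
(* If [M] is invertible on [T], the product rule turns the ansatz [M c] into
   [M(sigma) c^Delta = f], which gives the formula; two solutions differ by a
   solution of the homogeneous equation, so everything reduces to three facts.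
   - A homogeneous solution vanishing somewhere vanishes on all of [T]: its
     zero set spreads across dense points by the mean value inequality, and
     across gaps of [T], in both directions, because [1 + mu A] is invertible.
   - [M] is invertible on [T]: a kernel vector of [M t] would yield a
     homogeneous solution vanishing at [t], contradicting independence.
   - [M^-1(sigma) f] has an antiderivative: it is locally bounded and
     continuous at right-dense points, so its lower Darboux integral is one. *)

Require Import Defs.
From HB Require Import structures.
From mathcomp Require Import all_boot all_order all_algebra.
From mathcomp Require Import fingroup perm ring lra.
From mathcomp Require Import boolp classical_sets reals topology normedtype.

Set Implicit Arguments.
Unset Strict Implicit.
Unset Printing Implicit Defensive.

Import Order.TTheory GRing.Theory Num.Theory.
Import numFieldNormedType.Exports.

Local Open Scope classical_set_scope.
Local Open Scope ring_scope.

(** * The l1 norm on quaternion matrices *)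

(** Without commuting entries there is no determinant, so invertibility rests on a dichotomy: a
    square matrix is invertible or has a nonzero right kernel vector. The right kernel is the
    relevant one because [A] acts on the left and constants on the right: [M v] is again a
    homogeneous solution, and it is a right combination of the columns of [M]. The antiderivative is
    built for functions bounded on bounded intervals and continuous at right-dense points, two
    properties that pass easily to [M^-1(sigma) f]; left-sided limits of [f] enter through
    boundedness. Boundedness is enough at a right-scattered [t]: the increment across the gap is
    exact, and [sigma t - s] stays at least [mu t] for [s <= t], so what happens just left of [t] is
    negligible. A single induction principle carries every passage from local to global; it is also
    applied to the reflected set, to move left, and to the whole line, as a form of compactness. *)

Section QuaternionNorm.
Variable R : realType.
Implicit Types x y : quat R.

(* The l1 norm, unlike [qnorm], has a trivial triangle inequality, and it is
   still submultiplicative. *)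
Definition qnorm1 x : R := `|qre x| + `|qi x| + `|qj x| + `|qk x|.

Lemma quat_eq x y : qre x = qre y -> qi x = qi y -> qj x = qj y ->
  qk x = qk y -> x = y.
Proof. by case: x y => a b c d [a' b' c' d'] /= -> -> -> ->. Qed.

Lemma qnorm1_ge0 x : 0 <= qnorm1 x.
Proof. by rewrite !addr_ge0. Qed.

Lemma qnorm1D x y : qnorm1 (x + y) <= qnorm1 x + qnorm1 y.
Proof.
rewrite /qnorm1 /=.
have := ler_normD (qre x) (qre y); have := ler_normD (qi x) (qi y).
have := ler_normD (qj x) (qj y); have := ler_normD (qk x) (qk y).
lra.
Qed.

Lemma qnorm1N x : qnorm1 (- x) = qnorm1 x.
Proof. by rewrite /qnorm1 /= !normrN. Qed.

Lemma qnorm1_eq0 x : qnorm1 x <= 0 -> x = 0.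
Proof.
case: x => a b c d; rewrite /qnorm1 /= => h.
have := normr_ge0 a; have := normr_ge0 b.
have := normr_ge0 c; have := normr_ge0 d => *.
by congr Quat; apply/normr0_eq0; lra.
Qed.

Lemma ler_norm4 (a b c d : R) :
  `|a + b + c + d| <= `|a| + `|b| + `|c| + `|d|.
Proof.
by do 2!(apply: (le_trans (ler_normD _ _)); rewrite lerD2r); exact: ler_normD.
Qed.

(** The product of the two norms expands into sixteen terms, each of which occurs exactly once among
    the components of [x * y]; the triangle inequality does the rest. *)
Lemma qnorm1M x y : qnorm1 (x * y) <= qnorm1 x * qnorm1 y.
Proof.
case: x y => a b c d [a' b' c' d']; rewrite /qnorm1 /=.
have h1 := ler_norm4 (a * a') (- (b * b')) (- (c * c')) (- (d * d')).
have h2 := ler_norm4 (a * b') (b * a') (c * d') (- (d * c')).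
have h3 := ler_norm4 (a * c') (- (b * d')) (c * a') (d * b').
have h4 := ler_norm4 (a * d') (b * c') (- (c * b')) (d * a').
move: h1 h2 h3 h4; rewrite !normrN !normrM => h1 h2 h3 h4.
apply: le_trans (lerD (lerD (lerD h1 h2) h3) h4) _.
by rewrite le_eqVlt; apply/orP; left; apply/eqP; ring.
Qed.

Lemma qnorm1Z (c : R) x : qnorm1 (rquat c * x) = `|c| * qnorm1 x.
Proof.
case: x => a' b' c' d'; rewrite /qnorm1 /= !mul0r !subr0 !addr0.
by rewrite !normrM; ring.
Qed.

Lemma rquatC (c : R) x : rquat c * x = x * rquat c.
Proof. by case: x => a' b' c' d'; congr Quat => /=; ring. Qed.

Lemma rquatD (c d : R) : rquat (c + d) = rquat c + rquat d.
Proof. by congr Quat; rewrite /= addr0. Qed.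

(** With [qnorm1_le_qnorm], this trades the Euclidean norm of the definitions for the l1 norm. The
    factor 4 there counts components and is not sharp. *)
Lemma qnorm_le_qnorm1 x : qnorm x <= qnorm1 x.
Proof.
rewrite /qnorm -[leRHS]ger0_norm ?qnorm1_ge0// -sqrtr_sqr ler_sqrt ?sqr_ge0//.
rewrite /qsqn /qnorm1.
rewrite -(real_normK (num_real (qre x))) -(real_normK (num_real (qi x))).
rewrite -(real_normK (num_real (qj x))) -(real_normK (num_real (qk x))).
move: (normr_ge0 (qre x)) (normr_ge0 (qi x)) (normr_ge0 (qj x)).
move: (normr_ge0 (qk x)); nra.
Qed.

Lemma qnorm1_le_qnorm x : qnorm1 x <= 4 * qnorm x.
Proof.
have h (a : R) : a ^+ 2 <= qsqn x -> `|a| <= qnorm x.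
  by move=> ax; rewrite -sqrtr_sqr; apply: ler_wsqrtr.
have := (sqr_ge0 (qre x), sqr_ge0 (qi x), sqr_ge0 (qj x), sqr_ge0 (qk x)).
move=> [[[a0 b0] c0] d0].
have ha : `|qre x| <= qnorm x by apply: h; rewrite /qsqn; lra.
have hb : `|qi x| <= qnorm x by apply: h; rewrite /qsqn; lra.
have hc : `|qj x| <= qnorm x by apply: h; rewrite /qsqn; lra.
have hd : `|qk x| <= qnorm x by apply: h; rewrite /qsqn; lra.
rewrite /qnorm1; lra.
Qed.

Definition mxnorm1 m n (A : 'M[quat R]_(m, n)) : R :=
  \sum_i \sum_j qnorm1 (A i j).

Lemma mxnorm1_ge0 m n (A : 'M[quat R]_(m, n)) : 0 <= mxnorm1 A.
Proof. by do 2!(apply: sumr_ge0 => ? _); exact: qnorm1_ge0. Qed.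

Lemma le_mxnorm1 m n (A : 'M[quat R]_(m, n)) i j : qnorm1 (A i j) <= mxnorm1 A.
Proof.
rewrite /mxnorm1 (bigD1 i)//= (bigD1 j)//= -addrA lerDl addr_ge0//.
  by apply: sumr_ge0 => ? _; exact: qnorm1_ge0.
by do 2!(apply: sumr_ge0 => ? _); exact: qnorm1_ge0.
Qed.

Lemma mxnorm1_eq0 m n (A : 'M[quat R]_(m, n)) : mxnorm1 A <= 0 -> A = 0.
Proof.
move=> A0; apply/matrixP => i j; rewrite mxE; apply: qnorm1_eq0.
exact: le_trans (le_mxnorm1 A i j) A0.
Qed.

Lemma mxnorm10 m n : mxnorm1 (0 : 'M[quat R]_(m, n)) = 0.
Proof.
rewrite /mxnorm1 big1 // => i _; rewrite big1 // => j _.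
by rewrite mxE /qnorm1 /= normr0 !addr0.
Qed.

Lemma mxnorm1D m n (A B : 'M[quat R]_(m, n)) :
  mxnorm1 (A + B) <= mxnorm1 A + mxnorm1 B.
Proof.
rewrite /mxnorm1 -big_split; apply: ler_sum => i _.
rewrite -big_split; apply: ler_sum => j _; rewrite mxE; exact: qnorm1D.
Qed.

Lemma mxnorm1N m n (A : 'M[quat R]_(m, n)) : mxnorm1 (- A) = mxnorm1 A.
Proof. by do 2!(apply: eq_bigr => ? _); rewrite mxE qnorm1N. Qed.

Lemma mxnorm1B m n (A B : 'M[quat R]_(m, n)) :
  mxnorm1 (A - B) <= mxnorm1 A + mxnorm1 B.
Proof. by rewrite -(mxnorm1N B); exact: mxnorm1D. Qed.

Lemma mxnorm1_distrC m n (A B : 'M[quat R]_(m, n)) :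
  mxnorm1 (A - B) = mxnorm1 (B - A).
Proof. by rewrite -mxnorm1N opprB. Qed.

Lemma mxnorm1Z m n (c : R) (A : 'M[quat R]_(m, n)) :
  mxnorm1 (rquat c *: A) = `|c| * mxnorm1 A.
Proof.
rewrite /mxnorm1 mulr_sumr; apply: eq_bigr => i _.
by rewrite mulr_sumr; apply: eq_bigr => j _; rewrite mxE qnorm1Z.
Qed.

Lemma qnorm1_sum (I : Type) (r : seq I) (F : I -> quat R) :
  qnorm1 (\sum_(i <- r) F i) <= \sum_(i <- r) qnorm1 (F i).
Proof.
elim/big_ind2 : _ => //; first by rewrite /qnorm1 /= normr0 !addr0.
by move=> x1 x2 y1 y2 h1 h2; apply: le_trans (qnorm1D _ _) (lerD _ _).
Qed.

Lemma mxnorm1M m n p (A : 'M[quat R]_(m, n)) (B : 'M[quat R]_(n, p)) :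
  mxnorm1 (A *m B) <= mxnorm1 A * mxnorm1 B.
Proof.
have row_le j : \sum_k qnorm1 (B j k) <= mxnorm1 B.
  rewrite /mxnorm1 [leRHS](bigD1 j)//= lerDl.
  by do 2!(apply: sumr_ge0 => ? _); exact: qnorm1_ge0.
rewrite {1 2}/mxnorm1 mulr_suml; apply: ler_sum => i _; rewrite mulr_suml.
apply: (@le_trans _ _ (\sum_k \sum_j qnorm1 (A i j) * qnorm1 (B j k))).
  apply: ler_sum => k _; rewrite mxE; apply: le_trans (qnorm1_sum _ _) _.
  by apply: ler_sum => j _; exact: qnorm1M.
rewrite exchange_big; apply: ler_sum => j _.
by rewrite -mulr_sumr; apply: ler_wpM2l; rewrite ?qnorm1_ge0.
Qed.

(** Real quaternions are central; a general quaternion scalar could not be moved across [A]. *)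
Lemma scalemxAr_rquat m n p (c : R) (A : 'M[quat R]_(m, n))
    (B : 'M[quat R]_(n, p)) :
  A *m (rquat c *: B) = rquat c *: (A *m B).
Proof.
apply/matrixP => i k; rewrite !mxE mulr_sumr; apply: eq_bigr => j _.
by rewrite !mxE mulrA -rquatC mulrA.
Qed.

End QuaternionNorm.

(** * Invertible quaternion matrices *)

Section InverseOrKernel.
Variable R : realType.

Lemma qinvertibleM n (A B : 'M[quat R]_n) :
  qinvertible A -> qinvertible B -> qinvertible (A *m B).
Proof.
move=> [A' [AA' A'A]] [B' [BB' B'B]]; exists (B' *m A'); split.
  by rewrite -mulmxA (mulmxA B) BB' mul1mx.
by rewrite -mulmxA (mulmxA A') A'A mul1mx.
Qed.

Lemma qinvertible_perm n (s : 'S_n) : qinvertible (perm_mx s : 'M[quat R]_n).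
Proof.
by exists (perm_mx s^-1%g); split; rewrite -perm_mxM ?mulgV ?mulVg perm_mx1.
Qed.

(** Elimination with pivot [a], written as lower unitriangular times block diagonal times upper
    unitriangular. The inverse [a^-1] stands between [c] and [b], the order imposed by
    noncommutativity. *)
Lemma qinvertible_schur n (a : quat R) (b : 'rV[quat R]_n)
    (c : 'cV[quat R]_n) (d : 'M[quat R]_n) : a != 0 ->
  qinvertible (d - c *m (a^-1)%:M *m b) ->
  qinvertible (block_mx a%:M b c d : 'M_(1 + n)).
Proof.
move=> a0; set S := d - _ => -[S' [SS' S'S]].
have aU : a \is a GRing.unit by [].
have aV : a%:M *m (a^-1)%:M = 1%:M :> 'M_1 by rewrite -scalar_mxM divrr.
have Va : (a^-1)%:M *m a%:M = 1%:M :> 'M_1 by rewrite -scalar_mxM mulVr.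
have -> : block_mx a%:M b c d
    = block_mx 1%:M 0 (c *m (a^-1)%:M) 1%:M *m block_mx a%:M 0 0 S
      *m block_mx 1%:M ((a^-1)%:M *m b) 0 1%:M.
  rewrite !mulmx_block !(mul1mx, mulmx1, mul0mx, mulmx0, addr0, add0r).
  by rewrite -(mulmxA c) Va mulmx1 !mulmxA aV mul1mx /S addrC subrK.
apply: qinvertibleM; first apply: qinvertibleM.
- exists (block_mx 1%:M 0 (- (c *m (a^-1)%:M)) 1%:M); split;
  rewrite mulmx_block !(mul1mx, mulmx1, mul0mx, mulmx0, addr0, add0r);
  by rewrite ?subrr ?addNr -scalar_mx_block.
- exists (block_mx (a^-1)%:M 0 0 S'); split;
  rewrite mulmx_block !(mul1mx, mulmx1, mul0mx, mulmx0, addr0, add0r);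
  by rewrite ?aV ?Va ?SS' ?S'S -scalar_mx_block.
- exists (block_mx 1%:M (- ((a^-1)%:M *m b)) 0 1%:M); split;
  rewrite mulmx_block !(mul1mx, mulmx1, mul0mx, mulmx0, addr0, add0r);
  by rewrite ?subrr ?addNr -scalar_mx_block.
Qed.

(** Back substitution: the first block row determines the top entry from [v], after which the second
    one reduces to the Schur complement applied to [v]. *)
Lemma kernel_schur n (a : quat R) (b : 'rV[quat R]_n)
    (c : 'cV[quat R]_n) (d : 'M[quat R]_n) (v : 'cV[quat R]_n) : a != 0 ->
  (d - c *m (a^-1)%:M *m b) *m v = 0 ->
  block_mx a%:M b c d *m col_mx (- ((a^-1)%:M *m b *m v)) v = 0 :> 'cV_(1 + n).
Proof.
move=> a0 Sv.
have aU : a \is a GRing.unit by [].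
have aV : a%:M *m (a^-1)%:M = 1%:M :> 'M_1 by rewrite -scalar_mxM divrr.
rewrite mul_block_col !mulmxN !mulmxA aV mul1mx addNr.
by rewrite addrC -mulmxBl Sv col_mx0.
Qed.

(** Gaussian elimination by induction on the size. A nonzero entry of the first column is brought to
    the corner by a row exchange, which leaves the right kernel unchanged; if that column is zero,
    the first basis vector lies in the kernel. *)
Lemma qinvertible_or_kernel n (A : 'M[quat R]_n) :
  qinvertible A \/ exists2 v : 'cV[quat R]_n, v != 0 & A *m v = 0.
Proof.
elim: n A => [|n IHn] A.
  by left; exists 1%:M; split; apply/matrixP => -[].
have pivot (B : 'M[quat R]_(1 + n)) : B 0 0 != 0 ->
    qinvertible B \/ exists2 v : 'cV[quat R]_(1 + n), v != 0 & B *m v = 0.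
  move=> B0.
  have ul : ulsubmx B = (B 0 0)%:M.
    by rewrite [LHS]mx11_scalar !mxE !lshift0.
  rewrite -(submxK B) ul.
  case: (IHn (drsubmx B - dlsubmx B *m (B 0 0)^-1%:M *m ursubmx B)).
    by move=> h; left; exact: qinvertible_schur.
  move=> [v v0 Sv]; right; eexists; last exact: kernel_schur Sv.
  apply: contra v0 => /eqP h; apply/eqP.
  by have := congr1 dsubmx h; rewrite col_mxKd linear0.
have [[i Ai0]|A0] := pselect (exists i, A i 0 != 0).
  have Bi0 : xrow i 0 A 0 0 != 0 by rewrite /xrow mxE tpermR.
  have xrowK : A = perm_mx (tperm i 0) *m xrow i 0 A.
    by rewrite xrowE mulmxA -perm_mxM tperm2 perm_mx1 mul1mx.
  case: (pivot _ Bi0) => [Bu|[v v0 Bv]].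
    left; rewrite xrowK; apply: qinvertibleM => //; exact: qinvertible_perm.
  by right; exists v => //; rewrite xrowK -mulmxA [X in _ *m X]Bv mulmx0.
right; exists (delta_mx 0 0).
  apply/eqP => /matrixP/(_ 0 0); rewrite !mxE !eqxx /= => /eqP.
  by rewrite oner_eq0.
rewrite -colE; apply/matrixP => i j; rewrite !mxE.
by apply/eqP/negP => h; apply: A0; exists i; apply/negP.
Qed.

Lemma qinvmxP n (A : 'M[quat R]_n) : qinvertible A -> is_qinvmx A (qinvmx A).
Proof. by move=> [B AB]; exact: (@xgetI _ 0 _ B AB). Qed.

End InverseOrKernel.

(** * Induction on time scales *)

Section TimeScale.
Variable R : realType.
Implicit Types T : set R.

Lemma nearT_P T (t : R) (P : set R) :
  (\forall s \near within T (nbhs t), P s) <->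
  exists2 e : R, 0 < e & forall s, T s -> `|s - t| < e -> P s.
Proof.
rewrite near_withinE; split.
  move/nbhs_ballP => [e /= e0 h]; exists e => // s Ts st.
  by apply: (h s) => //; rewrite -ball_normE /ball_/= distrC.
move=> [e e0 h]; apply/nbhs_ballP; exists e => //= s.
by rewrite -ball_normE /ball_/= distrC => st Ts; exact: h.
Qed.

Lemma closed_limit T (x : R) : closed T ->
  (forall e : R, 0 < e -> exists2 s, T s & `|s - x| < e) -> T x.
Proof.
move=> clT h; apply: clT => B /nbhs_ballP[e /= e0 xB].
have [s Ts sx] := h e e0; exists s; split=> //; apply: xB.
by rewrite -ball_normE /ball_/= distrC.
Qed.

Lemma closed_opp T : closed T -> closed [set t | T (- t)].
Proof.
move=> clT; apply: (@preimage_closed _ _ (-%R : R -> R) T _ clT) => x _.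
exact: oppr_continuous.
Qed.

Definition consecutive T (u v : R) :=
  [/\ T u, T v, u < v & forall r, T r -> u < r -> v <= r].

(** If [P b] fails, let [c] be the supremum of the points up to which [P] holds. The left-dense case
    gives [P c] when the supremum is not attained; then the right-dense or the gap case pushes [P]
    beyond [c], a contradiction. *)
Lemma time_scale_ind T (a : R) (P : R -> Prop) : closed T -> T a -> P a ->
  (forall t, T t -> a <= t -> (forall r, T r -> a <= r <= t -> P r) ->
    (forall e : R, 0 < e -> exists2 r, T r & t < r < t + e) ->
    \forall s \near within T (nbhs t), t < s -> P s) ->
  (forall u v, consecutive T u v -> a <= u ->
    (forall r, T r -> a <= r <= u -> P r) -> P v) ->
  (forall t, T t -> a < t ->
    (forall e : R, 0 < e -> exists2 r, T r & t - e < r < t) ->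
    (forall r, T r -> a <= r < t -> P r) -> P t) ->
  forall t, T t -> a <= t -> P t.
Proof.
move=> clT Ta Pa right cons left b Tb ab; apply: contrapT => Pb.
pose W := [set w | T w /\ a <= w <= b /\ forall r, T r -> a <= r <= w -> P r].
have Wa : W a.
  by split=> //; split; rewrite ?lexx// => r Tr /le_anti <-.
have ubW : has_ubound W by exists b => w [_ [/andP[_ ?] _]].
have supW : has_sup W by split=> //; exists a.
pose c := sup W.
have ac : a <= c by exact: ub_le_sup.
have cb : c <= b by apply: ge_sup; [exists a | move=> w [_ [/andP[_ ?] _]]].
have Wnear (e : R) : 0 < e -> exists2 w, W w & c - e < w <= c.
  move=> e0; have [w Ww cw] := sup_adherent e0 supW.
  by exists w => //; rewrite cw /=; exact: ub_le_sup.
have Tc : T c.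
  apply: closed_limit => // e e0; have [w [Tw _] /andP[cw wc]] := Wnear e e0.
  by exists w => //; rewrite distrC ger0_norm ?subr_ge0//; lra.
have Pltc r : T r -> a <= r < c -> P r.
  move=> Tr /andP[ar rc]; have [|w [_ [_ Pw]] /andP[cw _]] := Wnear (c - r).
    by rewrite subr_gt0.
  by apply: Pw => //; rewrite ar; lra.
have Pc : P c.
  have [[_ [_ Pc]]|nWc] := pselect (W c); first by apply: Pc; rewrite ?ac/=.
  apply: left => //.
    by rewrite lt_neqAle ac andbT; apply/eqP => h; apply: nWc; rewrite -h.
  move=> e e0; have [w Ww /andP[cw wc]] := Wnear e e0.
  exists w; first by case: Ww.
  rewrite cw lt_neqAle wc andbT; apply/eqP => h; apply: nWc; by rewrite -h.
have Plec r : T r -> a <= r <= c -> P r.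
  move=> Tr /andP[ar]; rewrite le_eqVlt => /orP[/eqP->//|rc].
  by apply: Pltc; rewrite ?ar.
have cltb : c < b.
  by rewrite lt_neqAle cb andbT; apply/eqP => h; apply: Pb; rewrite -h.
have noW w : T w -> c < w <= b -> (forall r, T r -> c < r <= w -> P r) -> False.
  move=> Tw /andP[cw wb] Pw.
  have : w <= c; last by lra.
  apply: ub_le_sup => //; split=> //; split; first by rewrite wb andbT; lra.
  move=> r Tr /andP[ar rw]; case: (leP r c) => rc.
    by apply: Plec; rewrite ?ar.
  by apply: Pw; rewrite ?rc.
have [dense|] := pselect (forall e : R, 0 < e -> exists2 r, T r & c < r < c + e).
  have /nearT_P[e e0 h] := right c Tc ac Plec dense.
  have [r Tr /andP[cr re]] : exists2 r, T r & c < r < c + Num.min e (b - c).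
    by apply: dense; rewrite lt_min e0 subr_gt0.
  have [re1 re2] : r < c + e /\ r < b.
    by move: re; rewrite -ltrBlDl lt_min => /andP[]; split; lra.
  apply: (noW r Tr); first by rewrite cr ltW.
  move=> s Ts /andP[cs sr]; apply: h => //.
  by rewrite ger0_norm ?subr_ge0; lra.
move=> /existsNP[e /not_implyP[e0 ne]].
(* No point of [T] lies strictly between [c] and [c + e], so the infimum [v] of the later points
   belongs to [T] and closes a gap starting at [c]. *)
pose D := [set r | T r /\ c < r].
have Db : D b by [].
have lbD : lbound D (c + e).
  move=> r [Tr cr]; rewrite leNgt; apply/negP => re; apply: ne.
  by exists r; rewrite ?cr.
have infD : has_inf D by split; [exists b | exists (c + e)].
pose v := inf D.
have cv : c + e <= v by apply: lb_le_inf => //; exists b.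
have Tv : T v.
  apply: closed_limit => // d d0; have [w [Tw cw] wv] := inf_adherent d0 infD.
  exists w => //; rewrite ger0_norm; first by rewrite /v; lra.
  by rewrite subr_ge0; apply: ge_inf => //; case: infD.
have vD r : T r -> c < r -> v <= r.
  by move=> Tr cr; apply: ge_inf => //; case: infD.
have vb : v <= b by exact: vD.
apply: (noW v Tv); first by rewrite vb andbT; lra.
move=> r Tr /andP[cr rv]; have -> : r = v by apply/le_anti; rewrite rv vD.
by apply: (cons c) => //; split=> //; lra.
Qed.

(** Meant for zero sets of solutions, which have to be followed both ways. Moving left is
    [time_scale_ind] on the reflected set, where gaps are entered from their right end; hence the
    equivalence in the gap hypothesis. *)
Lemma time_scale_spread T (a : R) (P : R -> Prop) : closed T -> T a -> P a ->
  (forall t, T t -> P t -> \forall s \near within T (nbhs t), P s) ->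
  (forall t, T t ->
    (forall e : R, 0 < e -> exists2 r, T r & `|r - t| < e /\ P r) -> P t) ->
  (forall u v, consecutive T u v -> P u <-> P v) ->
  forall t, T t -> P t.
Proof.
move=> clT Ta Pa loc lim cons.
have fwd t : T t -> a <= t -> P t.
  move: t; apply: time_scale_ind => //.
  - move=> t Tt at_ Pt _; near=> s => _; near: s; apply: loc => //.
    by apply: Pt; rewrite ?lexx ?at_.
  - by move=> u v uv au Pu; apply/(cons u) => //; apply: Pu;
      rewrite ?lexx ?au//; case: uv.
  - move=> t Tt at_ acc Pt; apply: lim => // e e0.
    have [|r Tr /andP[r1 r2]] := acc (Num.min e (t - a)).
      by rewrite lt_min e0 subr_gt0.
    have [re ra] : t - e < r /\ a < r.
      by move: r1; rewrite ltrBlDr -ltrBlDl lt_min => /andP[]; split; lra.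
    exists r => //; split; last by apply: Pt => //; rewrite r2 ltW.
    by rewrite distrC ger0_norm ?subr_ge0; lra.
have bwd t : T (- t) -> - a <= t -> P (- t).
  move: t; apply: (@time_scale_ind [set t | T (- t)]) => /=; rewrite ?opprK//.
  - exact: closed_opp.
  - move=> t Tt at_ Pt _.
    have /(loc _ Tt)/nearT_P[e e0 h] : P (- t) by apply: Pt; rewrite ?lexx ?at_.
    apply/nearT_P; exists e => // s Ts st _; apply: h => //.
    by rewrite -opprD normrN.
  - move=> u v [/= Tu Tv uv nuv] au Pu.
    apply/(cons (- v) (- u)); last by apply: Pu; rewrite ?lexx ?au.
    split; rewrite ?ltrN2// => r Tr vr.
    rewrite leNgt; apply/negP => ru; have := nuv (- r).
    rewrite opprK => /(_ Tr); lra.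
  - move=> t Tt at_ acc Pt; apply: lim => // e e0.
    have [|r Tr /andP[r1 r2]] := acc (Num.min e (t + a)).
      by rewrite lt_min e0; lra.
    have [re ra] : t - e < r /\ - a < r.
      by move: r1; rewrite ltrBlDr -ltrBlDl lt_min => /andP[]; split; lra.
    exists (- r) => //; split; last by apply: Pt => //; rewrite r2 ltW.
    by rewrite ger0_norm; lra.
move=> t Tt; case: (leP a t) => [|ta]; first exact: fwd.
by rewrite -[t]opprK; apply: bwd; rewrite ?opprK//; lra.
Unshelve. all: by end_near.
Qed.

(** The equality [sigma T t = t] hides two situations that later proofs treat differently: [t] is
    the maximum of [T], where the convention [sup T] applies, or points of [T] accumulate at [t]
    from the right. *)
Lemma sigma_scatteredP T t : closed T -> T t ->
  (sigma T t = t /\ ((forall r, T r -> r <= t) \/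
     forall e : R, 0 < e -> exists2 r, T r & t < r < t + e)) \/
  consecutive T t (sigma T t).
Proof.
move=> clT Tt; rewrite /sigma; case: asboolP => [ne|empty].
  set D := [set s | _] in ne *.
  have lbD : has_lbound D by exists t => r [_ /ltW].
  have infD : has_inf D by [].
  have Dle r : T r -> t < r -> inf D <= r by move=> *; apply: ge_inf.
  have tD : t <= inf D by apply: lb_le_inf => // r [_ /ltW].
  have acc e : 0 < e -> exists2 r, T r & t < r < inf D + e.
    by move=> e0; have [r [Tr tr] ?] := inf_adherent e0 infD; exists r; rewrite ?tr.
  move: tD; rewrite le_eqVlt => /orP[/eqP tD|tD].
    left; split=> //; right => e e0; rewrite {2}tD; exact: acc.
  right; split=> //; apply: closed_limit => // e e0.
  have [r Tr /andP[tr re]] := acc e e0; exists r => //.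
  by rewrite ger0_norm ?subr_ge0 ?Dle//; lra.
have maxt r : T r -> r <= t.
  by move=> Tr; rewrite leNgt; apply/negP => tr; apply: empty; exists r.
left; split; last by left.
apply/le_anti/andP; split; first by apply: ge_sup; [exists t | exact: maxt].
by apply: ub_le_sup => //; exists t; exact: maxt.
Qed.

Lemma sigma_in T t : closed T -> T t -> T (sigma T t).
Proof. by move=> clT Tt; case: (sigma_scatteredP clT Tt) => [[->]|[]]. Qed.

Lemma sigma_ge T t : closed T -> T t -> t <= sigma T t.
Proof. by move=> clT Tt; case: (sigma_scatteredP clT Tt) => [[->]|[_ _ /ltW]]. Qed.

Lemma sigma_le T t r : closed T -> T t -> T r -> t < r -> sigma T t <= r.
Proof.
by move=> clT Tt Tr tr; case: (sigma_scatteredP clT Tt) => [[-> _]|[_ _ _]];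
  [exact: ltW | exact].
Qed.

Lemma consecutive_sigma T u v : closed T -> consecutive T u v -> sigma T u = v.
Proof.
move=> clT [Tu Tv uv nuv]; apply/le_anti; rewrite sigma_le//=.
case: (sigma_scatteredP clT Tu) => [[_ [/(_ v Tv)|acc]]|[_ ? ? _]].
- lra.
- by have [|r Tr] := acc (v - u); [lra | have := nuv r Tr; lra].
- exact: nuv.
Qed.

Lemma rho_scattered T t : T t -> rho T t <> t ->
  exists2 e : R, 0 < e & forall r, T r -> r < t -> r <= t - e.
Proof.
move=> Tt; rewrite /rho; case: asboolP => [ne|empty _]; last first.
  by exists 1 => // r Tr rt; case: empty; exists r.
set D := [set s | _] in ne *.
have ubD : has_ubound D by exists t => r [_ /ltW].
move=> Dt; exists (t - sup D).
  rewrite subr_gt0 lt_neqAle; apply/andP; split; first exact/eqP.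
  by apply: ge_sup => // r [_ /ltW].
by move=> r Tr rt; rewrite subKr; exact: ub_le_sup.
Qed.

Lemma le_rho T t r : T r -> r < t -> r <= rho T t.
Proof.
move=> Tr rt; rewrite /rho asboolT; last by exists r.
by apply: ub_le_sup => //; exists t => s [_ /ltW].
Qed.

Lemma kappa_lt T t b : T t -> T b -> t < b -> kappa T t.
Proof.
move=> Tt Tb tb; split=> // ubT /andP[rt _].
have : t <= rho T (sup T); last by lra.
by apply: le_rho => //; apply: lt_le_trans tb _; exact: ub_le_sup.
Qed.

(** Such a [t] can only be a maximum of [T] with [rho T t < t]. Continuity there is automatic, which
    makes up for the absence of a derivative. *)
Lemma not_kappa_isolated T t : T t -> ~ kappa T t ->
  \forall s \near within T (nbhs t), s = t.
Proof.
move=> Tt nk.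
have [ubT /andP[rt ts]] : has_ubound T /\ rho T (sup T) < t <= sup T.
  by apply: contrapT => h; apply: nk; split=> // ubT ts; apply: h.
have tsup : t = sup T.
  apply/eqP; rewrite eq_le ts /= leNgt; apply/negP => /(le_rho Tt); lra.
apply/nearT_P; exists (t - rho T t); first by rewrite {2}tsup; lra.
move=> s Ts st; apply/eqP; rewrite eq_le; apply/andP; split.
  by rewrite tsup; exact: ub_le_sup.
rewrite leNgt; apply/negP => s_t; have := le_rho Ts s_t.
by move: st; rewrite distrC ger0_norm; lra.
Qed.

(** Compactness of a bounded interval, by [time_scale_ind] on the whole line instead of [T]: a point
    outside the closed set [T] has a neighbourhood free of [T], where any bound holds, and the gap
    case is void. *)
Lemma locally_bounded T (g : R -> R) : closed T ->
  (forall t, T t -> exists K, \forall s \near within T (nbhs t), g s <= K) ->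
  forall a b : R, exists K, forall t, T t -> a <= t <= b -> g t <= K.
Proof.
move=> clT locT a b.
have loc (t : R) : exists K, exists2 e : R, 0 < e &
    forall s, T s -> `|s - t| < e -> g s <= K.
  have [/locT[K /nearT_P h]|nTt] := pselect (T t); first by exists K.
  exists 0; apply: contrapT => h; apply: nTt; apply: closed_limit => // e e0.
  apply: contrapT => noT; apply: h; exists e => // s Ts st.
  by case: noT; exists s.
case: (ltP b a) => [ba|ab]; first by exists 0 => t _ /andP[]; lra.
pose P t := exists K, forall r, T r -> a <= r <= t -> g r <= K.
suff : forall t, [set: R] t -> a <= t -> P t by exact.
apply: (time_scale_ind closedT) => //.
- by exists (g a) => r Tr /le_anti <-.
- move=> t _ at_ Pt _; have [|K hK] := Pt t I; first by rewrite at_ lexx.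
  have [K' [e e0 hK']] := loc t.
  apply/nearT_P; exists e => // s _ st ts.
  exists (Num.max K K') => r Tr /andP[ar rs]; rewrite le_max.
  case: (leP r t) => rt; first by rewrite hK// ar.
  apply/orP; right; apply: hK' => //.
  by move: st; rewrite !ger0_norm; lra.
- move=> u v [_ _ uv /(_ ((u + v) / 2) I) nuv]; exfalso.
  by have := nuv; lra.
- move=> t _ at_ _ Pt; have [K' [e e0 hK']] := loc t.
  pose w := Num.max a (t - e / 2).
  have [aw we wt] : [/\ a <= w, t - e / 2 <= w & w < t].
    by rewrite /w !le_max gt_max !lexx orbT at_; split=> //; lra.
  have [|K hK] := Pt w I; first by rewrite aw.
  exists (Num.max K K') => r Tr /andP[ar rt]; rewrite le_max.
  case: (leP r w) => rw; first by rewrite hK ?ar.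
  apply/orP; right; apply: hK' => //.
  by rewrite distrC ger0_norm; lra.
Qed.

End TimeScale.

(** * Delta derivatives *)

Section DeltaDerivative.
Variable R : realType.
Implicit Types T : set R.

Lemma le0_small (x k : R) : 0 <= k ->
  (forall e : R, 0 < e -> x <= e * k) -> x <= 0.
Proof.
move=> k0 h; rewrite leNgt; apply/negP => x0.
have := h (x / (2 * (k + 1))); rewrite divr_gt0//; last by lra.
move=> /(_ isT); have -> : x / (2 * (k + 1)) * k = x * (k / (2 * (k + 1))).
  by field; lra.
have : k / (2 * (k + 1)) < 1 by rewrite ltr_pdivrMr; lra.
nra.
Qed.

Lemma near_here T t (P : set R) : T t ->
  (\forall s \near within T (nbhs t), P s) -> P t.
Proof. by move=> Tt /nearT_P[e e0]; apply; rewrite ?subrr ?normr0. Qed.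

(** One norm for the whole matrix replaces the entrywise condition of [is_delta_deriv_mx], and the
    real increment, being central, is written on the left. *)
Definition delta_deriv1 T m n (F : R -> 'M[quat R]_(m, n)) t d :=
  forall eps : R, 0 < eps -> \forall s \near within T (nbhs t),
    mxnorm1 (F (sigma T t) - F s - rquat (sigma T t - s) *: d)
      <= eps * `|sigma T t - s|.

Definition continuous1 T m n (F : R -> 'M[quat R]_(m, n)) t :=
  forall eps : R, 0 < eps ->
    \forall s \near within T (nbhs t), mxnorm1 (F s - F t) <= eps.

Lemma is_delta_deriv_nearP T (g : R -> quat R) t d :
  is_delta_deriv T g t d <->
  forall eps : R, 0 < eps -> \forall s \near within T (nbhs t),
    qnorm (g (sigma T t) - g s - d * rquat (sigma T t - s))
      <= eps * `|sigma T t - s|.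
Proof.
split=> h eps e0; have := h eps e0.
  move=> [e [e1 he]]; apply/nearT_P; exists e => // s Ts.
  by rewrite ltr_distl => /(he _ Ts).
move/nearT_P => [e e1 he]; exists e; split=> // s Ts.
by rewrite -ltr_distl; exact: he.
Qed.

Lemma is_delta_deriv_mxP T m n (F : R -> 'M[quat R]_(m, n)) t d :
  is_delta_deriv_mx T F t d <-> delta_deriv1 T F t d.
Proof.
split=> [h eps e0 | h i j].
  (* 4 is the cost of passing from [qnorm] to [qnorm1], [n * m] the number of entries; the successor
     keeps [k] positive for empty matrices. *)
  have [k k0 kE] : exists2 k : R, 0 < k & k = (4 * (n * m).+1)%:R.
    by eexists; last reflexivity; rewrite ltr0n.
  have : \forall s \near within T (nbhs t), forall ij : 'I_m * 'I_n,
      qnorm (F (sigma T t) ij.1 ij.2 - F s ij.1 ij.2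
             - d ij.1 ij.2 * rquat (sigma T t - s))
      <= eps / k * `|sigma T t - s|.
    apply: filter_forall => -[i j]; move: (h i j) => /is_delta_deriv_nearP; apply.
    by rewrite divr_gt0.
  apply: filterS => s hs; set D := `|_| in hs *.
  apply: (@le_trans _ _ (\sum_(i < m) \sum_(j < n) 4 * (eps / k * D))).
    apply: ler_sum => i _; apply: ler_sum => j _.
    apply: le_trans (qnorm1_le_qnorm _) _; rewrite ler_wpM2l//.
    by have := hs (i, j); rewrite !mxE rquatC.
  rewrite sumr_const card_ord sumr_const card_ord -mulrnA -[_ *+ (n * m)]mulr_natl.
  have -> : (n * m)%:R * (4 * (eps / k * D)) = (4 * (n * m))%:R / k * (eps * D).
    by rewrite [(4 * _)%:R]natrM; field; rewrite gt_eqF.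
  rewrite -[leRHS]mul1r ler_wpM2r ?mulr_ge0 ?(ltW e0)//; first exact: normr_ge0.
  by rewrite ler_pdivrMr// mul1r kE ler_nat leq_mul2l leqnSn orbT.
apply/is_delta_deriv_nearP => eps e0.
apply: filterS (h eps e0) => s; apply: le_trans.
apply: le_trans (qnorm_le_qnorm1 _) _.
apply: le_trans (le_mxnorm1 _ i j); by rewrite !mxE rquatC.
Qed.

(** Taking [s = t] in the definition bounds the defect by [e * |mu T t|] for every positive [e].
    This exact identity transports information across gaps. *)
Lemma delta_deriv1_sigma T m n (F : R -> 'M[quat R]_(m, n)) t d : T t ->
  delta_deriv1 T F t d -> F (sigma T t) = F t + rquat (mu T t) *: d.
Proof.
move=> Tt dF; apply/eqP; rewrite -subr_eq0 opprD addrA; apply/eqP/mxnorm1_eq0.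
apply: (@le0_small _ `|mu T t|) => // e e0; exact: near_here (dF e e0).
Qed.

Lemma near_dist T (t e : R) : 0 < e ->
  \forall s \near within T (nbhs t), `|s - t| < e.
Proof. by move=> e0; apply/nearT_P; exists e. Qed.

(** [F s - F t] is [(s - t) d] minus the derivative remainder at [s]. For [s] within 1 of [t] that
    remainder is at most a small multiple of [mu T t + 1], even when [sigma T t] is far from [t]. *)
Lemma delta_deriv1_continuous T m n (F : R -> 'M[quat R]_(m, n)) t d :
  closed T -> T t -> delta_deriv1 T F t d -> continuous1 T F t.
Proof.
move=> clT Tt dF eps e0.
have mu0 : 0 <= mu T t by rewrite subr_ge0 sigma_ge.
pose K := mxnorm1 d; have K0 : 0 <= K by exact: mxnorm1_ge0.
pose k := mu T t + 1 + K; have k0 : 0 < k by rewrite /k; lra.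
have ek : 0 < eps / k by rewrite divr_gt0.
have h1 := dF (eps / k) ek; have h2 := near_dist T t ek.
have h3 : \forall s \near within T (nbhs t), `|s - t| < 1 by exact: near_dist.
near=> s.
have Ft := delta_deriv1_sigma Tt dF.
have -> : F s - F t = rquat (s - t) *: d
    - (F (sigma T t) - F s - rquat (sigma T t - s) *: d).
  rewrite Ft; have -> : mu T t = (s - t) + (sigma T t - s) by rewrite /mu; lra.
  rewrite rquatD scalerDl; set X := _ *: d; set Y := _ *: d.
  by apply/matrixP => i j; rewrite !mxE; apply: quat_eq => /=; ring.
apply: le_trans (mxnorm1B _ _) _; rewrite mxnorm1Z -/K.
have d1 : mxnorm1 (F (sigma T t) - F s - rquat (sigma T t - s) *: d)
    <= eps / k * `|sigma T t - s| by near: s.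
have d2 : `|s - t| < eps / k by near: s.
have d3 : `|s - t| < 1 by near: s.
have d4 : `|sigma T t - s| <= mu T t + 1.
  have := ler_distD t (sigma T t) s.
  rewrite -/(mu T t) (ger0_norm mu0) (distrC t); lra.
have -> : eps = eps / k * (mu T t + 1) + eps / k * K.
  by rewrite -mulrDr -/k divfK// gt_eqF.
have := normr_ge0 (s - t); have := normr_ge0 (sigma T t - s); nra.
Unshelve. all: by end_near.
Qed.

Lemma delta_deriv1B T m n (F G : R -> 'M[quat R]_(m, n)) t F' G' :
  delta_deriv1 T F t F' -> delta_deriv1 T G t G' ->
  delta_deriv1 T (fun s => F s - G s) t (F' - G').
Proof.
move=> dF dG eps e0; have e2 : 0 < eps / 2 by rewrite divr_gt0.
apply: filterS2 (dF _ e2) (dG _ e2) => s; rewrite scalerBr.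
move: (F (sigma T t)) (G (sigma T t)) (F s) (G s) (_ *: F') (_ *: G').
move=> X Y Z U V W hF hG.
have -> : X - Y - (Z - U) - (V - W) = (X - Z - V) - (Y - U - W).
  by apply/matrixP => i j; rewrite !mxE; apply: quat_eq => /=; ring.
apply: le_trans (mxnorm1B _ _) _; rewrite [eps](splitr eps) mulrDl.
exact: lerD.
Qed.

End DeltaDerivative.

(** * Product rule, continuity of products and inverses, mean value inequality *)

Section MeanValue.
Variable R : realType.
Implicit Types T : set R.

(** The error splits into [F (sigma T t)] times the remainder of [G], the remainder of [F] times
    [G s], and [F'] times [G s - G t] scaled by the increment. The three summands of [k] bound the
    cofactors, with [kG + 1] bounding [G s] near [t]. *)
Lemma delta_deriv1M T m n p (F : R -> 'M[quat R]_(m, n))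
    (G : R -> 'M[quat R]_(n, p)) t F' G' : closed T -> T t ->
  delta_deriv1 T F t F' -> delta_deriv1 T G t G' ->
  delta_deriv1 T (fun s => F s *m G s) t (F' *m G t + F (sigma T t) *m G').
Proof.
move=> clT Tt dF dG eps e0; have contG := delta_deriv1_continuous clT Tt dG.
pose kF := mxnorm1 (F (sigma T t)); have kF0 : 0 <= kF by exact: mxnorm1_ge0.
pose kG := mxnorm1 (G t); have kG0 : 0 <= kG by exact: mxnorm1_ge0.
pose kF' := mxnorm1 F'; have kF'0 : 0 <= kF' by exact: mxnorm1_ge0.
pose k := kF + (kG + 1) + kF'; have k0 : 0 < k by rewrite /k; lra.
have ek : 0 < eps / k by rewrite divr_gt0.
have hF := dF _ ek; have hG := dG _ ek; have cG := contG _ ek.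
have cG1 := contG _ (@ltr01 R).
near=> s.
have -> : F (sigma T t) *m G (sigma T t) - F s *m G s
    - rquat (sigma T t - s) *: (F' *m G t + F (sigma T t) *m G')
    = F (sigma T t) *m (G (sigma T t) - G s - rquat (sigma T t - s) *: G')
      + (F (sigma T t) - F s - rquat (sigma T t - s) *: F') *m G s
      + (rquat (sigma T t - s) *: F') *m (G s - G t).
  rewrite scalerDr !mulmxBr !mulmxBl scalemxAr_rquat -!scalemxAl.
  move: (F (sigma T t) *m G (sigma T t)) (F (sigma T t) *m G s) (F s *m G s).
  move: (F' *m G t) (F' *m G s) (F (sigma T t) *m G') => U V W X Y Z.
  move: (_ *: U) (_ *: V) (_ *: W) => {}U {}V {}W.
  by apply/matrixP => i j; rewrite !mxE; apply: quat_eq => /=; ring.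
have h1 : mxnorm1 (F (sigma T t) - F s - rquat (sigma T t - s) *: F')
    <= eps / k * `|sigma T t - s| by near: s.
have h2 : mxnorm1 (G (sigma T t) - G s - rquat (sigma T t - s) *: G')
    <= eps / k * `|sigma T t - s| by near: s.
have h3 : mxnorm1 (G s - G t) <= eps / k by near: s.
have h4 : mxnorm1 (G s) <= kG + 1.
  rewrite -[G s](subrK (G t)); apply: le_trans (mxnorm1D _ _) _.
  by rewrite addrC lerD2l; near: s.
have -> : eps = kF * (eps / k) + (kG + 1) * (eps / k) + kF' * (eps / k).
  by rewrite -!mulrDl -/k mulrC divfK// gt_eqF.
apply: le_trans (mxnorm1D _ _) _; rewrite [leRHS]mulrDl; apply: lerD.
  apply: le_trans (mxnorm1D _ _) _; rewrite mulrDl; apply: lerD.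
    by apply: le_trans (mxnorm1M _ _) _; rewrite -mulrA ler_wpM2l.
  apply: le_trans (mxnorm1M _ _) _; rewrite -mulrA [leRHS]mulrC.
  by rewrite ler_pM ?mxnorm1_ge0.
apply: le_trans (mxnorm1M _ _) _; rewrite mxnorm1Z -/kF' [leRHS]mulrC [leRHS]mulrA.
by rewrite ler_wpM2l ?mulr_ge0.
Unshelve. all: by end_near.
Qed.

Lemma continuous1M T m n p (F : R -> 'M[quat R]_(m, n))
    (G : R -> 'M[quat R]_(n, p)) t :
  continuous1 T F t -> continuous1 T G t ->
  continuous1 T (fun s => F s *m G s) t.
Proof.
move=> cF cG eps e0.
pose kF := mxnorm1 (F t); have kF0 : 0 <= kF by exact: mxnorm1_ge0.
pose kG := mxnorm1 (G t); have kG0 : 0 <= kG by exact: mxnorm1_ge0.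
pose k := kF + (kG + 1); have k0 : 0 < k by rewrite /k; lra.
have ek : 0 < eps / k by rewrite divr_gt0.
have hF := cF _ ek; have hG := cG _ ek; have cG1 := cG _ (@ltr01 R).
near=> s.
have -> : F s *m G s - F t *m G t = F t *m (G s - G t) + (F s - F t) *m G s.
  by rewrite mulmxBr mulmxBl [RHS]addrC subrKA.
have h4 : mxnorm1 (G s) <= kG + 1.
  rewrite -[G s](subrK (G t)); apply: le_trans (mxnorm1D _ _) _.
  by rewrite addrC lerD2l; near: s.
have -> : eps = kF * (eps / k) + (eps / k) * (kG + 1).
  by rewrite [X in _ + X]mulrC -!mulrDl -/k mulrC divfK// gt_eqF.
apply: le_trans (mxnorm1D _ _) _; apply: lerD.
  by apply: le_trans (mxnorm1M _ _) _; rewrite ler_wpM2l//; near: s.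
apply: le_trans (mxnorm1M _ _) _; rewrite ler_pM ?mxnorm1_ge0//; by near: s.
Unshelve. all: by end_near.
Qed.

(** Resolvent identity [N s - N t = N s (M t - M s) N t]. As [N s] has no bound in advance, its norm
    is estimated by [x + b], where [x] is the quantity sought; the first term of [k] makes the
    coefficient of [x] at most 1/2, so that it can be absorbed, and the second makes the rest at
    most [eps / 2]. *)
Lemma continuous1_qinvmx T n (M N : R -> 'M[quat R]_n) t : T t ->
  (forall s, T s -> is_qinvmx (M s) (N s)) ->
  continuous1 T M t -> continuous1 T N t.
Proof.
move=> Tt MN cM eps e0.
pose b := mxnorm1 (N t); have b0 : 0 <= b by exact: mxnorm1_ge0.
pose k := Num.min (1 / (2 * (b + 1))) (eps / (2 * (b ^+ 2 + 1))).
have k0 : 0 < k.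
  by rewrite lt_min !divr_gt0//; have := sqr_ge0 b; lra.
have /nearT_P[e e1 he] := cM k k0; apply/nearT_P; exists e => // s Ts st.
have [_ NMs] := MN s Ts; have [MNt _] := MN t Tt.
have NB : N s - N t = N s *m (M t - M s) *m N t.
  by rewrite mulmxBr mulmxBl NMs mul1mx -mulmxA MNt mulmx1.
set x := mxnorm1 (N s - N t).
set d := mxnorm1 (M t - M s).
have d0 : 0 <= d by exact: mxnorm1_ge0.
have dk : d <= k by rewrite /d mxnorm1_distrC he.
have x0 : 0 <= x by exact: mxnorm1_ge0.
have Ns : mxnorm1 (N s) <= x + b.
  by rewrite -{1}[N s](subrK (N t)); exact: mxnorm1D.
have xle : x <= (x + b) * d * b.
  rewrite /x {1}NB; apply: le_trans (mxnorm1M _ _) _; rewrite ler_wpM2r//.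
  by apply: le_trans (mxnorm1M _ _) _; rewrite ler_wpM2r.
have db : d * b <= 1 / 2.
  have : d <= 1 / (2 * (b + 1)) by apply: le_trans dk _; rewrite ge_min lexx.
  rewrite ler_pdivlMr; lra.
have db2 : d * (b ^+ 2 + 1) <= eps / 2.
  have : d <= eps / (2 * (b ^+ 2 + 1)).
    by apply: le_trans dk _; rewrite ge_min lexx orbT.
  rewrite ler_pdivlMr; last by have := sqr_ge0 b; lra.
  lra.
have xdb : x * (d * b) <= x * (1 / 2) by rewrite ler_wpM2l.
have : (x + b) * d * b = x * (d * b) + d * b ^+ 2 by ring.
lra.
Qed.

(** Induction along [T] with slope [C + eps]: the slack absorbs the derivative error at right-dense
    points, gaps are crossed exactly by [delta_deriv1_sigma], and left-dense points follow by
    continuity. Then [eps] tends to 0. *)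
Lemma mean_value T m n (F F' : R -> 'M[quat R]_(m, n)) (C a b : R) :
  closed T -> T a -> T b -> a <= b -> 0 <= C ->
  (forall t, T t -> continuous1 T F t) ->
  (forall t, T t -> a <= t < b -> delta_deriv1 T F t (F' t)) ->
  (forall t, T t -> a <= t < b -> mxnorm1 (F' t) <= C) ->
  mxnorm1 (F b - F a) <= C * (b - a).
Proof.
move=> clT Ta Tb ab C0 cF dF bF.
rewrite -subr_le0; apply: (@le0_small _ _ (b - a)); first by rewrite subr_ge0.
move=> eps e0; rewrite lerBlDr -mulrDl (addrC eps).
pose P t := t <= b -> mxnorm1 (F t - F a) <= (C + eps) * (t - a).
suff : forall t, T t -> a <= t -> P t by move=> /(_ b Tb ab); apply.
have step u v C' : mxnorm1 (F u - F a) <= (C + eps) * (u - a) ->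
    mxnorm1 (F v - F u) <= C' -> C' <= (C + eps) * (v - u) ->
    mxnorm1 (F v - F a) <= (C + eps) * (v - a).
  move=> h1 h2 h3; rewrite -(subrKA (F u)).
  apply: le_trans (mxnorm1D _ _) _; lra.
apply: time_scale_ind => //.
- by move=> _; rewrite !subrr mxnorm10 mulr0.
- move=> t Tt at_ Pt acc; case: (ltP t b) => tb; last first.
    by apply: nearW => s ts sb; exfalso; lra.
  have st : sigma T t = t.
    case: (sigma_scatteredP clT Tt) => [[]//|[_ _ ts nts]].
    have [|r Tr /andP[tr rs]] := acc (sigma T t - t); first by rewrite subr_gt0.
    by have := nts r Tr tr; lra.
  have t_ab : a <= t < b by rewrite at_.
  have := dF t Tt t_ab eps e0; apply: filterS => s hs ts sb.
  apply: (step t s (C * (s - t) + eps * (s - t))); last by rewrite mulrDl.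
    by apply: Pt; rewrite ?lexx ?at_ ?ltW.
  move: hs; rewrite st => hs; rewrite mxnorm1_distrC.
  have -> : F t - F s = rquat (t - s) *: F' t
      + (F t - F s - rquat (t - s) *: F' t).
    by rewrite [RHS]addrC subrK.
  have ts0 : `|t - s| = s - t by rewrite distrC ger0_norm ?subr_ge0 ?ltW.
  rewrite ts0 in hs; apply: le_trans (mxnorm1D _ _) _; apply: lerD => //.
  by rewrite mxnorm1Z ts0 mulrC ler_wpM2r ?subr_ge0 ?bF// ltW.
- move=> u v uv au Pu vb; have [Tu Tv ltuv _] := uv.
  have u_ab : a <= u < b by rewrite au (lt_le_trans ltuv).
  apply: (step u v (C * (v - u))).
  - by apply: Pu; rewrite ?lexx ?au// ltW// (lt_le_trans ltuv).
  - have := delta_deriv1_sigma Tu (dF u Tu u_ab).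
    rewrite /mu (consecutive_sigma clT uv) => ->; rewrite addrC addKr.
    rewrite mxnorm1Z ger0_norm; last by rewrite subr_ge0 ltW.
    by rewrite mulrC ler_wpM2r ?bF// subr_ge0 ltW.
  - by rewrite ler_wpM2r ?subr_ge0 1?ltW//; lra.
- move=> t Tt at_ acc Pt tb.
  rewrite -subr_le0; apply: (@le0_small _ _ 1) => // e1 e10; rewrite mulr1.
  have /nearT_P[e2 e20 h] := cF t Tt e1 e10.
  have [|w Tw /andP[w1 w2]] := acc (Num.min e2 (t - a)).
    by rewrite lt_min e20 subr_gt0.
  have [we wa] : t - e2 < w /\ a < w.
    by move: w1; rewrite ltrBlDr -ltrBlDl lt_min => /andP[]; split; lra.
  have hw : mxnorm1 (F w - F a) <= (C + eps) * (w - a).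
    by apply: Pt => //; rewrite ?ltW//= ?(lt_le_trans w2)// ltW.
  have hwt : mxnorm1 (F t - F w) <= e1.
    by rewrite mxnorm1_distrC h// distrC ger0_norm ?subr_ge0 ?ltW//; lra.
  rewrite -(subrKA (F w)); have := mxnorm1D (F t - F w) (F w - F a).
  have : (C + eps) * (w - a) <= (C + eps) * (t - a).
    by rewrite ler_wpM2l// ?lerD2r ?ltW//; lra.
  lra.
Qed.

Lemma kappa_deriv_continuous T m n (F F' : R -> 'M[quat R]_(m, n)) :
  closed T -> (forall t, kappa T t -> delta_deriv1 T F t (F' t)) ->
  forall t, T t -> continuous1 T F t.
Proof.
move=> clT dF t Tt; have [kt|nkt] := pselect (kappa T t).
  exact: delta_deriv1_continuous (dF t kt).
move=> eps e0; apply: filterS (not_kappa_isolated Tt nkt) => s ->.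
by rewrite subrr mxnorm10 ltW.
Qed.

End MeanValue.

(** * Uniqueness for linear equations *)

Section RdContinuous.
Variable R : realType.
Implicit Types T : set R.

Lemma rd_continuousR_right_dense T (g : R -> R) t : rd_continuousR T g ->
  T t -> sigma T t = t -> forall eps : R, 0 < eps ->
  \forall s \near within T (nbhs t), `|g s - g t| <= eps.
Proof.
move=> [gr _] Tt st eps e0; have /cvgrPdist_le/(_ eps e0) := gr t (conj Tt st).
by apply: filterS => s; rewrite distrC.
Qed.

(** Continuity settles a right-dense [t]. Otherwise no point of [T] follows [t] closely, and just
    before [t] either a left limit exists or there are no points at all. *)
Lemma rd_continuousR_locally_bounded T (g : R -> R) t : closed T ->
  rd_continuousR T g -> T t ->
  exists K, \forall s \near within T (nbhs t), `|g s| <= K.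
Proof.
move=> clT grd Tt.
case: (sigma_scatteredP clT Tt) => [[st _]|[_ _ ts nts]].
  exists (`|g t| + 1); have := rd_continuousR_right_dense grd Tt st (@ltr01 R).
  apply: filterS => s hs; rewrite -{1}(subrK (g t) (g s)).
  by apply: le_trans (ler_normD _ _) _; rewrite addrC lerD2l.
have [e [K [e0 hK]]] : exists e K : R, 0 < e /\
    forall s, T s -> s < t -> t - s < e -> `|g s| <= K.
  have [rt|/(rho_scattered Tt)[e e0 he]] := pselect (rho T t = t); last first.
    by exists e, 0; split=> // s Ts /(he s Ts); lra.
  have [l /cvgrPdist_le/(_ 1 ltr01)] := grd.2 t (conj Tt rt).
  rewrite near_withinE => /nbhs_ballP[e /= e0 he].
  exists e, (`|l| + 1); split=> // s Ts st tse.
  have : `|l - g s| <= 1.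
    by apply: he => //; rewrite -ball_normE /ball_/= ger0_norm// subr_ge0 ltW.
  move=> h; rewrite -(subrK l (g s)); apply: le_trans (ler_normD _ _) _.
  by rewrite addrC distrC lerD2l.
exists (Num.max K `|g t|); apply/nearT_P.
exists (Num.min e (sigma T t - t)); first by rewrite lt_min e0 subr_gt0.
move=> s Ts; rewrite lt_min => /andP[se ss]; rewrite le_max.
case: (ltgtP s t) => [st|t_s|->]; last by rewrite lexx orbT.
  by rewrite hK//; move: se; rewrite distrC ger0_norm ?subr_ge0// ltW.
exfalso; move: ss; rewrite ltr_distl => /andP[_ ss].
by have := nts s Ts t_s; lra.
Qed.

Lemma rd_continuous_locally_bounded T (g : R -> quat R) t : closed T ->
  rd_continuous T g -> T t ->
  exists K, \forall s \near within T (nbhs t), qnorm1 (g s) <= K.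
Proof.
move=> clT [g1 g2 g3 g4] Tt.
have [K1 h1] := rd_continuousR_locally_bounded clT g1 Tt.
have [K2 h2] := rd_continuousR_locally_bounded clT g2 Tt.
have [K3 h3] := rd_continuousR_locally_bounded clT g3 Tt.
have [K4 h4] := rd_continuousR_locally_bounded clT g4 Tt.
exists (K1 + K2 + K3 + K4); near=> s.
by rewrite /qnorm1 !lerD//; near: s.
Unshelve. all: by end_near.
Qed.

Lemma rd_continuous_mx_bounded T m n (g : R -> 'M[quat R]_(m, n)) :
  closed T -> rd_continuous_mx T g ->
  forall a b, exists K, forall t, T t -> a <= t <= b -> mxnorm1 (g t) <= K.
Proof.
move=> clT grd; apply: locally_bounded => // t Tt.
have /choice[K hK] : forall ij : 'I_m * 'I_n, exists K,
    \forall s \near within T (nbhs t), qnorm1 (g s ij.1 ij.2) <= K.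
  by move=> ij; exact: rd_continuous_locally_bounded (grd _ _) Tt.
exists (\sum_i \sum_j K (i, j)).
have : \forall s \near within T (nbhs t),
    forall ij, qnorm1 (g s ij.1 ij.2) <= K ij by exact: filter_forall.
apply: filterS => s hs; apply: ler_sum => i _; apply: ler_sum => j _.
exact: hs (i, j).
Qed.

Lemma rd_continuous_mx_right_dense T m n (g : R -> 'M[quat R]_(m, n)) t :
  rd_continuous_mx T g -> T t -> sigma T t = t -> continuous1 T g t.
Proof.
move=> grd Tt st eps e0.
have [k k0 kE] : exists2 k : R, 0 < k & k = (4 * (n * m).+1)%:R.
  by eexists; last reflexivity; rewrite ltr0n.
have : \forall s \near within T (nbhs t), forall ij : 'I_m * 'I_n,
    qnorm1 (g s ij.1 ij.2 - g t ij.1 ij.2) <= 4 * (eps / k).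
  apply: filter_forall => -[i j] /=; have [g1 g2 g3 g4] := grd i j.
  have ek : 0 < eps / k by rewrite divr_gt0.
  have h1 := rd_continuousR_right_dense g1 Tt st ek.
  have h2 := rd_continuousR_right_dense g2 Tt st ek.
  have h3 := rd_continuousR_right_dense g3 Tt st ek.
  have h4 := rd_continuousR_right_dense g4 Tt st ek.
  near=> s.
  have -> : 4 * (eps / k) = eps / k + eps / k + eps / k + eps / k by ring.
  by rewrite /qnorm1 !lerD//; near: s.
apply: filterS => s hs.
apply: (@le_trans _ _ (\sum_(i < m) \sum_(j < n) 4 * (eps / k))).
  apply: ler_sum => i _; apply: ler_sum => j _; rewrite !mxE; exact: hs (i, j).
rewrite sumr_const card_ord sumr_const card_ord -mulrnA -[_ *+ (n * m)]mulr_natl.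
have -> : (n * m)%:R * (4 * (eps / k)) = (4 * (n * m))%:R / k * eps.
  by rewrite [(4 * _)%:R]natrM; field; rewrite gt_eqF.
rewrite -[leRHS]mul1r ler_wpM2r ?(ltW e0)//.
by rewrite ler_pdivrMr// mul1r kE ler_nat leq_mul2l leqnSn orbT.
Unshelve. all: by end_near.
Qed.

Lemma continuous1_bounded T m n (F : R -> 'M[quat R]_(m, n)) : closed T ->
  (forall t, T t -> continuous1 T F t) ->
  forall a b, exists K, forall t, T t -> a <= t <= b -> mxnorm1 (F t) <= K.
Proof.
move=> clT cF; apply: locally_bounded => // t Tt.
exists (mxnorm1 (F t) + 1); apply: filterS (cF t Tt 1 ltr01) => s hs.
rewrite -{1}(subrK (F t) (F s)); apply: le_trans (mxnorm1D _ _) _.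
by rewrite addrC lerD2l.
Qed.

(* Near a zero [s], the mean value inequality bounds the maximum [m] of [x]
   between [s] and a point at distance at most 1 / (2 (K + 1)) by [m / 2]. *)
Lemma linear_zero_locally T n p (A : R -> 'M[quat R]_n)
    (x : R -> 'M[quat R]_(n, p)) s : closed T -> rd_continuous_mx T A ->
  (forall t, kappa T t -> delta_deriv1 T x t (A t *m x t)) ->
  T s -> x s = 0 -> \forall r \near within T (nbhs s), x r = 0.
Proof.
move=> clT Ard dx Ts xs0.
have cx := kappa_deriv_continuous clT dx.
have [K0 hK0] := rd_continuous_mx_bounded clT Ard (s - 1) (s + 1).
pose K := Num.max K0 0.
have K_ge0 : 0 <= K by rewrite le_max lexx orbT.
have hK t : T t -> `|t - s| <= 1 -> mxnorm1 (A t) <= K.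
  move=> Tt; rewrite ler_distl => /(hK0 _ Tt) h.
  by rewrite le_max h.
pose d := Num.min 1 (1 / (2 * (K + 1))).
have d0 : 0 < d by rewrite lt_min ltr01 divr_gt0//; lra.
have d1 : d <= 1 by rewrite ge_min lexx.
have dK : K * d <= 1 / 2.
  have : d <= 1 / (2 * (K + 1)) by rewrite ge_min lexx orbT.
  rewrite ler_pdivlMr; lra.
apply/nearT_P; exists d => // r Tr rs.
(* The zero [s] is one end of this interval, so a single estimate serves for [r] on either side of
   it. *)
pose lo := Num.min r s; pose hi := Num.max r s.
have Tlo : T lo by rewrite /lo minEle; case: ifP.
have Thi : T hi by rewrite /hi maxEle; case: ifP.
have [lor los] : lo <= r /\ lo <= s by rewrite !ge_min !lexx orbT.
have [rhi shi] : r <= hi /\ s <= hi by rewrite !le_max !lexx orbT.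
have lohi : hi - lo < d.
  move: rs; rewrite ltr_distl => /andP[rs1 rs2].
  by rewrite /lo /hi minEle maxEle; case: (leP r s) => _; lra.
have [B hB] := continuous1_bounded clT cx lo hi.
pose S := [set mxnorm1 (x u) | u in [set u | T u /\ lo <= u <= hi]].
have Sr : S (mxnorm1 (x r)) by exists r => //; split=> //; rewrite lor.
have supS : has_sup S.
  by split; [exists (mxnorm1 (x r)) | exists B => _ [u [Tu u_lohi] <-]; exact: hB].
pose m := sup S.
have hm u : T u -> lo <= u <= hi -> mxnorm1 (x u) <= m.
  by move=> Tu ulh; apply: ub_le_sup; [case: supS | exists u].
have m0 : 0 <= m by apply: le_trans (hm r Tr _); rewrite ?mxnorm1_ge0 ?lor.
have mv u v : T u -> T v -> u <= v -> lo <= u -> v <= hi ->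
    mxnorm1 (x v - x u) <= m / 2.
  move=> Tu Tv uv lou vhi.
  apply: (@le_trans _ _ ((K * m) * (v - u))); last first.
    apply: (@le_trans _ _ ((K * m) * d)); last first.
      by rewrite mulrAC [leRHS]mulrC ler_wpM2r//; lra.
    by rewrite ler_wpM2l ?mulr_ge0//; lra.
  have Km0 : 0 <= K * m by exact: mulr_ge0.
  apply: (mean_value (T := T) (F' := fun t => A t *m x t)) => //.
    by move=> t Tt /andP[ut tv]; apply: dx; exact: kappa_lt tv.
  move=> t Tt /andP[ut tv]; apply: le_trans (mxnorm1M _ _) _.
  rewrite ler_pM ?mxnorm1_ge0//.
    by apply: hK => //; rewrite ler_distl; apply/andP; split; lra.
  by apply: hm => //; apply/andP; split; lra.
have half u : T u -> lo <= u <= hi -> mxnorm1 (x u) <= m / 2.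
  move=> Tu /andP[lou uhi]; case: (leP s u) => su.
    by rewrite -[x u]subr0 -xs0; exact: mv.
  rewrite -[x u]opprK mxnorm1N -[- x u]add0r -xs0; apply: mv => //; exact: ltW.
have : m <= m / 2.
  by apply: ge_sup; [case: supS | move=> _ [u [Tu ulh] <-]; exact: half].
move=> m2; apply: mxnorm1_eq0; apply: le_trans (hm r Tr _) _; last by lra.
by rewrite lor.
Qed.

Lemma linear_zero T n p (A : R -> 'M[quat R]_n)
    (x : R -> 'M[quat R]_(n, p)) a : closed T -> rd_regressive T A ->
  (forall t, kappa T t -> delta_deriv1 T x t (A t *m x t)) ->
  T a -> x a = 0 -> forall t, T t -> x t = 0.
Proof.
move=> clT [Ard Areg] dx Ta xa0.
apply: (time_scale_spread (P := fun t => x t = 0) clT Ta xa0).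
- by move=> t Tt xt0; exact: linear_zero_locally xt0.
- move=> t Tt h; apply: mxnorm1_eq0; apply: (@le0_small _ _ 1) => // e e0.
  have /nearT_P[d d0 hd] := kappa_deriv_continuous clT dx Tt e0.
  have [r Tr [rt xr0]] := h d d0; rewrite mulr1.
  by have := hd r Tr rt; rewrite xr0 sub0r mxnorm1N.
- move=> u v uv; have [Tu Tv ltuv _] := uv.
  have ku : kappa T u by exact: kappa_lt ltuv.
  have := delta_deriv1_sigma Tu (dx u ku); rewrite (consecutive_sigma clT uv).
  rewrite scalemxAl -{1}[x u]mul1mx -mulmxDl => ->.
  have [B [_ BA]] := Areg u ku; split=> [->|h]; first by rewrite mulmx0.
  by rewrite -[x u]mul1mx -BA -mulmxA h mulmx0.
Qed.

End RdContinuous.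

(** * Antiderivatives *)

Section Antiderivative.
Variable R : realType.
Implicit Types T : set R.

(* The lower Darboux sums of [g] between [u] and [v]; only values of [g] at
   points of [T] count, which amounts to extending [g] by the value at the
   left endpoint to each gap of [T]. *)
Inductive lower_sum T (g : R -> R) : R -> R -> R -> Prop :=
| lower_sum1 u v c : u <= v -> T u ->
    (forall t, T t -> u <= t < v -> c <= g t) ->
    lower_sum T g u v (c * (v - u))
| lower_sum_cat u v w x y :
    lower_sum T g u v x -> lower_sum T g v w y -> lower_sum T g u w (x + y).

Lemma lower_sum_leq T g u v x : lower_sum T g u v x -> u <= v.
Proof. by elim=> {u v x} // u v w x y _ uv _; exact: le_trans. Qed.

Lemma lower_sum_le T g u v x C : lower_sum T g u v x ->
  (forall t, T t -> u <= t < v -> g t <= C) -> x <= C * (v - u).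
Proof.
elim=> {u v x} [u v c uv Tu hc|u v w x y hx IHx hy IHy] hC.
  (* On a degenerate piece [c] is unconstrained, but it is multiplied by 0. Otherwise the left
     endpoint [u], required to lie in [T], is a test point giving [c <= g u <= C]. *)
  move: uv; rewrite le_eqVlt => /orP[/eqP ->|uv]; first by rewrite subrr !mulr0.
  have uuv : u <= u < v by rewrite lexx.
  by rewrite ler_wpM2r ?subr_ge0 ?(ltW uv)// (le_trans (hc u Tu uuv))// hC.
have uv := lower_sum_leq hx; have vw := lower_sum_leq hy.
have : x <= C * (v - u).
  by apply: IHx => t Tt /andP[ut tv]; rewrite hC// ut (lt_le_trans tv).
have : y <= C * (w - v).
  by apply: IHy => t Tt /andP[vt tw]; rewrite hC// tw (le_trans uv).
lra.
Qed.

(** Gives one half of the additivity of the lower integral, the other half being concatenation. The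
    cut [v] must lie in [T] because it becomes a left endpoint. *)
Lemma lower_sum_split T g u w z v : lower_sum T g u w z -> T v ->
  u <= v <= w -> exists x y,
    [/\ lower_sum T g u v x, lower_sum T g v w y & z = x + y].
Proof.
move=> h Tv; elim: h => {u w z} [u w c uw Tu hc|u v' w x y hx IHx hy IHy].
  move=> /andP[uv vw]; exists (c * (v - u)), (c * (w - v)); split; last by ring.
    by constructor=> // t Tt /andP[ut tv]; rewrite hc// ut (lt_le_trans tv).
  by constructor=> // t Tt /andP[vt tw]; rewrite hc// tw (le_trans uv).
move=> /andP[uv vw]; case: (leP v v') => vv'.
  have [|x1 [x2 [h1 h2 ->]]] := IHx; first by rewrite uv.
  by exists x1, (x2 + y); split; rewrite ?addrA//; exact: lower_sum_cat h2 hy.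
have [|y1 [y2 [h1 h2 ->]]] := IHy; first by rewrite vw ltW.
by exists (x + y1), y2; split; rewrite ?addrA//; exact: lower_sum_cat hx h1.
Qed.

(** [G] is the signed lower Darboux integral from [t0]. The supremum of lower sums is additive and
    lies between the constant bounds, and this is all that differentiation will use. *)
Lemma additive_between T (t0 : R) (g : R -> R) : T t0 ->
  (forall a b, exists K, forall t, T t -> a <= t <= b -> `|g t| <= K) ->
  exists G : R -> R, forall u v c C, T u -> T v -> u <= v ->
    (forall r, T r -> u <= r < v -> c <= g r <= C) ->
    c * (v - u) <= G v - G u <= C * (v - u).
Proof.
move=> Tt0 bg.
pose L u v := sup [set x | lower_sum T g u v x].
have supL u v : T u -> T v -> u <= v -> has_sup [set x | lower_sum T g u v x].
  move=> Tu Tv uv; have [K hK] := bg u v.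
  have gK t : T t -> u <= t < v -> - K <= g t <= K.
    by move=> Tt /andP[ut tv]; rewrite -ler_norml hK// ut ltW.
  split; first by exists (- K * (v - u)); constructor=> // t Tt /(gK t Tt)/andP[].
  by exists (K * (v - u)) => x /lower_sum_le; apply=> t Tt /(gK t Tt)/andP[].
have Lbound u v c C : T u -> T v -> u <= v ->
    (forall r, T r -> u <= r < v -> c <= g r <= C) ->
    c * (v - u) <= L u v <= C * (v - u).
  move=> Tu Tv uv gcC; have [ne ub] := supL u v Tu Tv uv; apply/andP; split.
    by apply: ub_le_sup => //; constructor=> // t Tt /(gcC t Tt)/andP[].
  by apply: ge_sup => // x /lower_sum_le; apply=> t Tt /(gcC t Tt)/andP[].
have Ladd u v w : T u -> T v -> T w -> u <= v -> v <= w ->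
    L u w = L u v + L v w.
  move=> Tu Tv Tw uv vw; have uw := le_trans uv vw.
  have [ne1 ub1] := supL u v Tu Tv uv; have [ne2 ub2] := supL v w Tv Tw vw.
  have [ne3 ub3] := supL u w Tu Tw uw.
  apply/le_anti/andP; split.
    apply: ge_sup => // z /= /lower_sum_split/(_ Tv); rewrite uv vw.
    by move=> /(_ isT)[x [y [hx hy ->]]]; apply: lerD; exact: ub_le_sup.
  rewrite -lerBrDr; apply: ge_sup => // x hx; rewrite lerBrDr -lerBrDl.
  apply: ge_sup => // y hy; rewrite lerBrDl; apply: ub_le_sup => //.
  exact: lower_sum_cat hx hy.
exists (fun t => if t0 <= t then L t0 t else - L t t0) => u v c C Tu Tv uv gcC.
suff -> : (if t0 <= v then L t0 v else - L v t0)
    - (if t0 <= u then L t0 u else - L u t0) = L u v by exact: Lbound.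
case: (leP t0 u) => u0.
  by rewrite (le_trans u0 uv) (Ladd t0 u v)// addrC addKr.
case: (leP t0 v) => v0; first by rewrite (Ladd u t0 v) ?(ltW u0)// opprK addrC.
by rewrite (Ladd u v t0) ?(ltW v0)// opprK addrC addrK.
Qed.

(** At a right-dense [t], continuity puts [g] within [eps] of [g t], and the bounds on [G] conclude.
    At a right-scattered [t], the increment of [G] over the gap is exactly [g t * mu T t], since [t]
    is the only point of [T] that counts there; the part from [s] to [t] is controlled by its
    length. *)
Lemma real_antiderivative T (t0 : R) (g : R -> R) : closed T -> T t0 ->
  (forall t, T t -> sigma T t = t -> forall eps : R, 0 < eps ->
    \forall s \near within T (nbhs t), `|g s - g t| <= eps) ->
  (forall a b, exists K, forall t, T t -> a <= t <= b -> `|g t| <= K) ->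
  exists G : R -> R, forall t, T t -> forall eps : R, 0 < eps ->
    \forall s \near within T (nbhs t),
      `|G (sigma T t) - G s - g t * (sigma T t - s)| <= eps * `|sigma T t - s|.
Proof.
move=> clT Tt0 cg bg; have [G GP] := additive_between Tt0 bg.
exists G => t Tt eps e0.
case: (sigma_scatteredP clT Tt) => [[st _]|[_ Ts ts nts]].
  have /nearT_P[e e1 he] := cg t Tt st eps e0.
  apply/nearT_P; exists e => // s Ts se; rewrite st.
  have Gbound u v : T u -> T v -> u <= v -> t - e < u -> v < t + e ->
      (g t - eps) * (v - u) <= G v - G u <= (g t + eps) * (v - u).
    move=> Tu Tv uv tu vt; apply: GP => // r Tr /andP[ur rv].
    rewrite -ler_distl; apply: he => //; rewrite ltr_distl.
    by apply/andP; split; lra.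
  move: se; rewrite ltr_distl => /andP[s1 s2].
  rewrite ler_norml; case: (leP s t) => h.
    have /andP[h1 h2] : (g t - eps) * (t - s) <= G t - G s <= (g t + eps) * (t - s).
      by apply: Gbound => //; lra.
    rewrite ger0_norm ?subr_ge0//; apply/andP; split; lra.
  have /andP[h1 h2] : (g t - eps) * (s - t) <= G s - G t <= (g t + eps) * (s - t).
    by apply: Gbound => //; lra.
  rewrite distrC ger0_norm; last by rewrite subr_ge0 ltW.
  apply/andP; split; lra.
have [K0 hK0] := bg (t - 1) t; pose K := Num.max K0 0.
have K0_ge0 : 0 <= K by rewrite le_max lexx orbT.
have hK r : T r -> t - 1 <= r <= t -> - K <= g r <= K.
  by move=> Tr rt; rewrite -ler_norml le_max hK0.
have m0 : 0 < mu T t by rewrite subr_gt0.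
have Gst : G (sigma T t) - G t = g t * (sigma T t - t).
  apply/esym/le_anti; apply: (GP t (sigma T t)) => //; first exact: ltW.
  move=> r Tr /andP[tr rs]; suff -> : r = t by rewrite lexx.
  apply/le_anti; rewrite tr andbT leNgt; apply/negP => /(nts r Tr); lra.
(* 1 keeps [s] where [K] bounds [g], [mu T t] excludes points right of [t], and the last term makes
   the error, at most [2 * K * (t - s)], smaller than [eps * mu T t]. *)
pose e := Num.min 1 (Num.min (mu T t) (eps * mu T t / (2 * (K + 1)))).
have e1 : 0 < e by rewrite !lt_min ltr01 m0 divr_gt0 ?mulr_gt0//; lra.
have [el1 elm elK] : [/\ e <= 1, e <= mu T t & e <= eps * mu T t / (2 * (K + 1))].
  by rewrite !ge_min !lexx !orbT.
apply/nearT_P; exists e => // s Ts'; rewrite ltr_distl => /andP[s1 s2].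
have st : s <= t.
  by rewrite leNgt; apply/negP => /(nts s Ts'); move: elm; rewrite /mu; lra.
have /andP[h1 h2] : - K * (t - s) <= G t - G s <= K * (t - s).
  by apply: GP => // r Tr /andP[sr rt]; apply: hK => //; apply/andP; split; lra.
have /andP[h3 h4] : - K <= g t <= K by apply: hK => //; apply/andP; split; lra.
have tse : (t - s) * (2 * (K + 1)) <= eps * mu T t.
  by rewrite -ler_pdivlMr; [apply: le_trans elK; lra | lra].
have h5 : - K * (t - s) <= g t * (t - s) by rewrite ler_wpM2r// subr_ge0.
have h6 : g t * (t - s) <= K * (t - s) by rewrite ler_wpM2r// subr_ge0.
have h7 : eps * mu T t <= eps * (sigma T t - s).
  by rewrite ler_wpM2l ?(ltW e0)// lerD2l lerN2.
rewrite [in leRHS]ger0_norm ?subr_ge0 ?(le_trans st (ltW ts))// ler_norml.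
apply/andP; split; lra.
Qed.

Lemma quat_antiderivative T (t0 : R) (g : R -> quat R) : closed T -> T t0 ->
  (forall t, T t -> sigma T t = t -> forall eps : R, 0 < eps ->
    \forall s \near within T (nbhs t), qnorm1 (g s - g t) <= eps) ->
  (forall a b, exists K, forall t, T t -> a <= t <= b -> qnorm1 (g t) <= K) ->
  exists G, is_antiderivative T g G.
Proof.
move=> clT Tt0 cg bg.
have comp (c : quat R -> R) : (forall x y, c (x - y) = c x - c y) ->
    (forall x, `|c x| <= qnorm1 x) -> exists G : R -> R, forall t, T t ->
      forall eps : R, 0 < eps -> \forall s \near within T (nbhs t),
      `|G (sigma T t) - G s - c (g t) * (sigma T t - s)|
        <= eps * `|sigma T t - s|.
  move=> cB cle; apply: (real_antiderivative clT Tt0) => [t Tt st eps e0|a b].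
    apply: filterS (cg t Tt st eps e0) => s; apply: le_trans.
    by rewrite -cB; exact: cle.
  by have [K hK] := bg a b; exists K => t Tt /(hK t Tt); exact: le_trans.
have cle (x : quat R) : [/\ `|qre x| <= qnorm1 x, `|qi x| <= qnorm1 x,
    `|qj x| <= qnorm1 x & `|qk x| <= qnorm1 x].
  rewrite /qnorm1; have := normr_ge0 (qre x); have := normr_ge0 (qi x).
  by have := normr_ge0 (qj x); have := normr_ge0 (qk x); split; lra.
have [//|x|G1 h1] := comp (@qre R); first by case: (cle x).
have [//|x|G2 h2] := comp (@qi R); first by case: (cle x).
have [//|x|G3 h3] := comp (@qj R); first by case: (cle x).
have [//|x|G4 h4] := comp (@qk R); first by case: (cle x).
exists (fun s => Quat (G1 s) (G2 s) (G3 s) (G4 s)) => t [Tt _].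
apply/is_delta_deriv_nearP => eps e0.
have e4 : 0 < eps / 4 by rewrite divr_gt0.
have {}h1 := h1 t Tt _ e4; have {}h2 := h2 t Tt _ e4.
have {}h3 := h3 t Tt _ e4; have {}h4 := h4 t Tt _ e4.
near=> s; apply: le_trans (qnorm_le_qnorm1 _) _; rewrite /qnorm1 /=.
rewrite !mulr0 !subr0 !add0r !addr0.
have -> : eps * `|sigma T t - s| = eps / 4 * `|sigma T t - s|
  + eps / 4 * `|sigma T t - s| + eps / 4 * `|sigma T t - s|
  + eps / 4 * `|sigma T t - s| by field.
by rewrite !lerD//; near: s.
Unshelve. all: by end_near.
Qed.

End Antiderivative.

(** * Variation of constants *)

Section FundamentalMatrix.
Variables (R : realType) (T : set R) (n : nat) (A M : R -> 'M[quat R]_n).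
Hypotheses (clT : closed T) (hA : rd_regressive T A).
Hypothesis hM : fundamental_matrix T A M.

Lemma fundamental_deriv t : kappa T t -> delta_deriv1 T M t (A t *m M t).
Proof.
move=> kt; apply/is_delta_deriv_mxP => i j; have := hM.1 j t kt i 0.
have -> : (A t *m col j (M t)) i 0 = (A t *m M t) i j.
  by rewrite !mxE; apply: eq_bigr => k _; rewrite mxE.
have -> : (fun s => col j (M s) i 0) = (fun s => M s i j).
  by apply/funext => s; rewrite mxE.
exact.
Qed.

Lemma delta_deriv1_cst m p (C : 'M[quat R]_(m, p)) t :
  delta_deriv1 T (fun=> C) t 0.
Proof.
move=> eps e0; apply: nearW => s.
by rewrite subrr scaler0 subr0 mxnorm10 mulr_ge0 // ltW.
Qed.

Lemma fundamental_invertible t : T t -> is_qinvmx (M t) (qinvmx (M t)).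
Proof.
move=> Tt; apply: qinvmxP; case: (qinvertible_or_kernel (M t)) => // -[v v0 Mv].
have Mv0 : forall s, T s -> M s *m v = 0.
  apply: (linear_zero clT hA _ Tt Mv) => s ks.
  have := delta_deriv1M clT ks.1 (fundamental_deriv ks) (delta_deriv1_cst v s).
  by rewrite mulmx0 addr0 -mulmxA.
case/eqP: v0; apply/matrixP => i j; rewrite ord1 mxE.
(* The entries of [v] serve as the right coefficients of the columns of [M]. *)
apply: (hM.2 (fun k => v k 0)) => s /Mv0; apply: etrans; apply/matrixP => k l.
rewrite summxE !mxE; apply: eq_bigr => k' _.
by rewrite !mxE big_ord1 !mxE !ord1 eqxx mulr1n.
Qed.

End FundamentalMatrix.

(** Once an antiderivative exists, [xget] selects a genuine one instead of the junk value, and its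
    value at [t0] cancels in the increments. *)
Lemma delta_int_mx_deriv (R : realType) (T : set R) m n
    (h : R -> 'M[quat R]_(m, n)) (t0 t : R) : closed T -> T t0 ->
  (forall t, T t -> sigma T t = t -> continuous1 T h t) ->
  (forall a b, exists K, forall t, T t -> a <= t <= b -> mxnorm1 (h t) <= K) ->
  kappa T t -> delta_deriv1 T (delta_int_mx T h t0) t (h t).
Proof.
move=> clT Tt0 ch bh kt; apply/is_delta_deriv_mxP => i j.
have [G hG] : exists G, is_antiderivative T (fun s => h s i j) G.
  apply: (quat_antiderivative clT Tt0) => [s Ts ss eps e0|a b].
    apply: filterS (ch s Ts ss eps e0) => r; apply: le_trans.
    by have := le_mxnorm1 (h r - h s) i j; rewrite !mxE.
  have [K hK] := bh a b; exists K => s Ts sab.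
  by apply: le_trans (hK s Ts sab); exact: le_mxnorm1.
have /(_ t kt) := xgetI (fun=> 0) hG.
move=> + eps e0 => /(_ eps e0)[d [d0 hd]]; exists d; split=> // s Ts st.
have := hd s Ts st; rewrite !mxE /delta_int; congr (qnorm _ <= _).
by rewrite opprB addrA subrK.
Qed.

Theorem theorem4p24 (R : realType) (T : set R) (n : nat)
    (A M : R -> 'M[quat R]_n) (t0 : R) (f : R -> 'cV[quat R]_n)
    (hT : time_scale T) (hA : rd_regressive T A)
    (hM : fundamental_matrix T A M) (ht0 : T t0)
    (hf : rd_continuous_mx T f) :
  let phiNH (q : 'cV[quat R]_n) (t : R) : 'cV[quat R]_n :=
    M t *m q
    + M t *m delta_int_mx T
               (fun tau => qinvmx (M (sigma T tau)) *m f tau) t0 t in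
  (forall q : 'cV[quat R]_n,
     is_solution T (fun t x => A t *m x + f t) (phiNH q)) /\
  (forall phi : R -> 'cV[quat R]_n,
     is_solution T (fun t x => A t *m x + f t) phi ->
     exists q : 'cV[quat R]_n, forall t, T t -> phi t = phiNH q t).
Proof.
have clT := hT.2; have dM := @fundamental_deriv _ _ _ _ _ hM.
have invM := fundamental_invertible clT hA hM.
pose N t := qinvmx (M t).
have contN t : T t -> continuous1 T N t.
  move=> Tt; apply: (continuous1_qinvmx Tt invM).
  exact: (kappa_deriv_continuous clT dM).
pose h tau := N (sigma T tau) *m f tau.
have conth t : T t -> sigma T t = t -> continuous1 T h t.
  move=> Tt st; apply: (continuous1M (F := fun s => N (sigma T s))); last first.
    exact: rd_continuous_mx_right_dense.
  move=> eps e0; rewrite st; have /nearT_P[e e1 he] := contN t Tt eps e0.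
  (* Continuity of [sigma] at [t]. If [t] is the maximum, [sigma T s] lies between [s] and [t];
     otherwise a point [r] of [T] just right of [t] caps [sigma T s] for all [s < r]. *)
  have near_sigma : exists2 d : R, 0 < d & forall s, T s -> `|s - t| < d ->
      `|sigma T s - t| < e.
    case: (sigma_scatteredP clT Tt) => [[_ [maxt|acc]]|[_ _]];
      last by rewrite st ltxx.
      exists e => // s Ts; rewrite !ltr_distl => /andP[s1 s2].
      have := sigma_ge clT Ts; have := maxt _ (sigma_in clT Ts) => *.
      by apply/andP; split; lra.
    have [r Tr /andP[tr re]] := acc e e1.
    exists (r - t); first by rewrite subr_gt0.
    move=> s Ts; rewrite !ltr_distl => /andP[s1 s2].
    have := sigma_ge clT Ts; have : sigma T s <= r by apply: sigma_le => //; lra.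
    by move=> *; apply/andP; split; lra.
  have [d d0 hd] := near_sigma.
  apply/nearT_P; exists d => // s Ts st'.
  by apply: he (sigma_in clT Ts) _; exact: hd.
have boundh a b : exists K, forall t, T t -> a <= t <= b -> mxnorm1 (h t) <= K.
  have [Kf hKf] := rd_continuous_mx_bounded clT hf a b.
  (* For [t <= b], [sigma T t] may exceed [b], but not a point [c] of [T] beyond [b]; if there is no
     such point, it stays in the interval. *)
  have [[c [Tc bc]]|noc] := pselect (exists c, T c /\ b < c).
    have [KN hKN] := continuous1_bounded clT contN a c.
    exists (KN * Kf) => t Tt /andP[at_ tb]; apply: le_trans (mxnorm1M _ _) _.
    rewrite ler_pM ?mxnorm1_ge0 ?hKf ?at_//; apply: hKN; first exact: sigma_in.
    by rewrite (le_trans at_ (sigma_ge clT Tt)) sigma_le// (le_lt_trans tb).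
  have [KN hKN] := continuous1_bounded clT contN a b.
  exists (KN * Kf) => t Tt /andP[at_ tb]; apply: le_trans (mxnorm1M _ _) _.
  rewrite ler_pM ?mxnorm1_ge0 ?hKf ?at_//; apply: hKN; first exact: sigma_in.
  rewrite (le_trans at_ (sigma_ge clT Tt)) /= leNgt; apply/negP => bs.
  by apply: noc; exists (sigma T t); split=> //; exact: sigma_in.
move=> phiNH.
have dphi q t : kappa T t ->
    delta_deriv1 T (phiNH q) t (A t *m phiNH q t + f t).
  move=> kt; have Tt := kt.1.
  have phiE : phiNH q = fun s => M s *m (q + delta_int_mx T h t0 s).
    by apply/funext => s; rewrite mulmxDr.
  have dq : delta_deriv1 T (fun s => q + delta_int_mx T h t0 s) t (h t).
    move=> eps e0; have := delta_int_mx_deriv clT ht0 conth boundh kt e0.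
    by apply: filterS => s; rewrite opprD addrACA subrr add0r.
  (* The product rule evaluates the left factor at [sigma T t], so [M (sigma T t)] meets its own
     inverse in [h t] and leaves [f t]. *)
  have := delta_deriv1M clT Tt (dM t kt) dq.
  rewrite phiE /= /h (mulmxA (M _) (N _)).
  by have [-> _] := invM _ (sigma_in clT Tt); rewrite mul1mx -mulmxA.
split=> [q t kt|phi sol]; first exact/is_delta_deriv_mxP/dphi.
(* The integral vanishes at [t0], so this [q] is forced by [phi t0 = M t0 q]; the difference then
   satisfies the homogeneous equation and vanishes at [t0]. *)
exists (N t0 *m phi t0) => t Tt; apply/eqP; rewrite -subr_eq0; apply/eqP.
move: t Tt; apply: (linear_zero clT hA (a := t0)) => // [t kt eps e0|].
  set q := N t0 *m _; have -> : A t *m (phi t - phiNH q t)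
      = (A t *m phi t + f t) - (A t *m phiNH q t + f t).
    by rewrite mulmxBr opprD addrACA subrr addr0.
  have /is_delta_deriv_mxP dsol := sol t kt.
  exact: delta_deriv1B dsol (dphi q t kt) eps e0.
rewrite /phiNH mulmxA (invM t0 ht0).1 mul1mx.
have -> : delta_int_mx T h t0 t0 = 0.
  by apply/matrixP => i j; rewrite !mxE /delta_int subrr.
by rewrite mulmx0 addr0 subrr.
Qed.
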